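(* Let $T^*>0$, let $p\ge1$ be an integer, and suppose $s\ge0$ if $p=1$ and $s>\tfrac12$ if $p>1$. For every $U_0=(u_0,v_0)\in X^s$ and $f\in L^1(0,T^*;H^{s-2}(\mathbb{T}))$ there exists $T\in(0,T^*]$, depending only on $\|U_0\|_{X^s}$ and $\|f\|_{L^1(0,T^*;H^{s-2}(\mathbb{T}))}$, such that the problem $$\partial_t u-\partial_x^2\partial_t u+u^p\partial_x u-\partial_x v=f,\qquad \partial_t v-\partial_x u=0,\qquad u(\cdot,0)=u_0,\ v(\cdot,0)=v_0,$$ has a unique (mild) solution $(u,v)\in C([0,T];X^s)$. Moreover, for every $0<T_1<T$ there is a neighborhood $\mathbb{V}$ of $(u_0,v_0,f)$ in $X^s\times L^1(0,T^*;H^{s-2}(\mathbb{T}))$ such that for every $(\tilde u_0,\tilde v_0,\tilde f)\in\mathbb{V}$ the corresponding mild solution $(\tilde u,\tilde v)$ exists in $C([0,T_1];X^s)$, and the map $(\tilde u_0,\tilde v_0,\tilde f)\mapsto(\tilde u,\tilde v)$ is Lipschitz from $\mathbb{V}$ into $C([0,T_1];X^s)$.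
   Context: $\mathbb{T}=\mathbb{R}/2\pi\mathbb{Z}$; $H^s(\mathbb{T})$ is the periodic Sobolev space of real-valued functions, norm $\|u\|_{H^s}^2=\sum_k(1+k^2)^s|\hat u_k|^2$; $X^s=H^s(\mathbb{T})\times H^{s-1}(\mathbb{T})$ with $\|(u,v)\|_{X^s}^2=\|u\|_{H^s}^2+\|v\|_{H^{s-1}}^2$. $(I-\partial_x^2)^{-1}$ is the Fourier multiplier $(1+k^2)^{-1}$; $A(u,v)=((I-\partial_x^2)^{-1}\partial_xv,\partial_xu)$; $G(u,v)=((I-\partial_x^2)^{-1}\partial_x(\tfrac{1}{p+1}u^{p+1}),0)$. A mild solution on $[0,T]$ is $U=(u,v)\in C([0,T];X^s)$ satisfying $U(t)=e^{tA}U_0-\int_0^te^{(t-\tau)A}G(U(\tau))d\tau+\int_0^te^{(t-\tau)A}((I-\partial_x^2)^{-1}f(\tau),0)d\tau$ for $t\in[0,T]$. *)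

(* Defs.v *)
From mathcomp Require Import all_boot all_order all_algebra.
From mathcomp Require Import all_classical all_reals all_analysis.
From mathcomp Require Import complex.
Set Implicit Arguments. Unset Strict Implicit. Unset Printing Implicit Defensive.
Import Order.TTheory GRing.Theory Num.Theory.
Import numFieldNormedType.Exports.
Local Open Scope classical_set_scope.
Local Open Scope ring_scope.
Local Open Scope complex_scope.

Definition itv0 (R : realType) (a : R) : set R := `[0, a].

(* Fourier-coefficient sequences on T = R/2piZ : k |-> u^_k,
   with u^_k = (1/2pi) \int_T u(x) e^{-ikx} dx. *)
Definition fseq (R : realType) := int -> R[i].
Definition state (R : realType) := (fseq R * fseq R)%type.

Definition psumZ (R : realType) (g : int -> R) (N : nat) : R :=
  \sum_(i < (N.*2).+1) g (i%:Z - N%:Z)%R.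
Definition sumZ (R : realType) (g : int -> R) : R := lim (psumZ g @ \oo).
Definition csumZ (R : realType) (g : int -> R[i]) : R[i] :=
  (sumZ (fun k => complex.Re (g k))) +i* (sumZ (fun k => complex.Im (g k))).
Definition csumN (R : realType) (g : nat -> R[i]) : R[i] :=
  (lim (series (fun n => complex.Re (g n)) @ \oo)) +i*
  (lim (series (fun n => complex.Im (g n)) @ \oo)).

Definition cabs2 (R : realType) (z : R[i]) : R :=
  complex.Re z ^+ 2 + complex.Im z ^+ 2.

Definition wgt (R : realType) (s : R) (k : int) : R := (1 + (k%:~R) ^+ 2) `^ s.

(* real-valued function: u^_{-k} = conj(u^_k) *)
Definition realseq (R : realType) (c : fseq R) : Prop :=
  forall k : int, c (- k)%R = (c k)^*.

Definition Hterm (R : realType) (s : R) (c : fseq R) (k : int) : R :=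
  wgt s k * cabs2 (c k).
Definition inH (R : realType) (s : R) (c : fseq R) : Prop :=
  realseq c /\ cvg (psumZ (Hterm s c) @ \oo).
Definition Hnorm (R : realType) (s : R) (c : fseq R) : R :=
  Num.sqrt (sumZ (Hterm s c)).

Definition inX (R : realType) (s : R) (U : state R) : Prop :=
  inH s U.1 /\ inH (s - 1) U.2.
Definition Xnorm (R : realType) (s : R) (U : state R) : R :=
  Num.sqrt (Hnorm s U.1 ^+ 2 + Hnorm (s - 1) U.2 ^+ 2).

Definition subS (R : realType) (a b : fseq R) : fseq R := fun k => a k - b k.
Definition subX (R : realType) (U V : state R) : state R :=
  (subS U.1 V.1, subS U.2 V.2).

(* Fourier multipliers: d/dx ~ ik ; (I - d^2/dx^2)^{-1} ~ (1+k^2)^{-1} *)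
Definition Dx (R : realType) (k : int) : R[i] := 'i * (k%:~R)%:C.
Definition Jinv (R : realType) (k : int) : R[i] := ((1 + (k%:~R) ^+ 2)^-1)%:C.
Arguments Dx {R} k.
Arguments Jinv {R} k.

(* the operator A(u,v) = ((I-d_x^2)^{-1} d_x v, d_x u), acting on mode k *)
Definition Amode (R : realType) (k : int) (ab : R[i] * R[i]) : R[i] * R[i] :=
  (Jinv k * Dx k * ab.2, Dx k * ab.1).

(* e^{tA} = sum_n t^n A^n / n!, computed mode by mode (A is a Fourier multiplier) *)
Definition expA (R : realType) (t : R) (U : state R) : state R :=
  (fun k => csumN (fun n => ((t ^+ n / (n`!)%:R)%:C *
                          (iter n (Amode k) (U.1 k, U.2 k)).1)),
   fun k => csumN (fun n => ((t ^+ n / (n`!)%:R)%:C *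
                          (iter n (Amode k) (U.1 k, U.2 k)).2))).

(* convolution of Fourier coefficients (= coefficients of the product) *)
Definition conv (R : realType) (a b : fseq R) : fseq R :=
  fun k => csumZ (fun j => a j * b (k - j)%R).
(* coefficients of u^{n+1} *)
Fixpoint convpow (R : realType) (a : fseq R) (n : nat) : fseq R :=
  match n with O => a | n'.+1 => conv (convpow a n') a end.

(* G(u,v) = ((I-d_x^2)^{-1} d_x (u^{p+1}/(p+1)), 0) *)
Definition Gnl (R : realType) (p : nat) (U : state R) : state R :=
  (fun k => Jinv k * Dx k * ((p.+1%:R)^-1)%:C * convpow U.1 p k, fun _ => 0).

Definition Fsrc (R : realType) (g : fseq R) : state R :=
  (fun k => Jinv k * g k, fun _ => 0).

Definition cint (R : realType) (h : R -> R[i]) (t : R) : R[i] :=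
  (Rintegral (@lebesgue_measure R) `[0, t] (fun x => complex.Re (h x))) +i*
  (Rintegral (@lebesgue_measure R) `[0, t] (fun x => complex.Im (h x))).

Definition inCX (R : realType) (s T : R) (U : R -> state R) : Prop :=
  (forall t, 0 <= t <= T -> inX s (U t)) /\
  (forall t, 0 <= t <= T -> forall e : R, 0 < e -> exists2 d : R, 0 < d &
     forall t', 0 <= t' <= T -> `|t' - t| < d -> Xnorm s (subX (U t') (U t)) < e).

(* f in L^1(0,Ts; H^{s-2}(T)) (a representative with f(t) in H^{s-2} for all t) *)
Definition inL1 (R : realType) (s Ts : R) (f : R -> fseq R) : Prop :=
  (forall t, 0 <= t <= Ts -> inH (s - 2) (f t)) /\
  (forall k, measurable_fun `[0, Ts] (fun t => complex.Re (f t k)) /\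
             measurable_fun `[0, Ts] (fun t => complex.Im (f t k))) /\
  (\int[@lebesgue_measure R]_(t in itv0 Ts) (Hnorm (s - 2) (f t))%:E < +oo)%E.
Definition L1norm (R : realType) (s Ts : R) (f : R -> fseq R) : R :=
  Rintegral (@lebesgue_measure R) `[0, Ts] (fun t => Hnorm (s - 2) (f t)).
Definition subF (R : realType) (f g : R -> fseq R) : R -> fseq R :=
  fun t => subS (f t) (g t).

Definition mild (R : realType) (s : R) (p : nat) (T : R) (U0 : state R)
    (f : R -> fseq R) (U : R -> state R) : Prop :=
  inCX s T U /\
  forall t, 0 <= t <= T -> forall k : int,
    (U t).1 k = (expA t U0).1 k
                - cint (fun tau => (expA (t - tau) (Gnl p (U tau))).1 k) t
                + cint (fun tau => (expA (t - tau) (Fsrc (f tau))).1 k) t /\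
    (U t).2 k = (expA t U0).2 k
                - cint (fun tau => (expA (t - tau) (Gnl p (U tau))).2 k) t
                + cint (fun tau => (expA (t - tau) (Fsrc (f tau))).2 k) t.

(* Main.v *)
(* Write <k> = (1 + k^2)^(1/2). On the k-th Fourier mode e^{tA} is a rotation by the
   angle t k/<k> in the coordinates (<k>^s u_k, <k>^(s-1) v_k), so it is an isometry of
   X^s and is Lipschitz in t. The nonlinearity gains one derivative, which is what a
   product costs: since <k> <= 2^(1/2) <j> <k-j>, the coefficients of u v are bounded by
   |u|_s |v|_s / <k>^s for every s >= 0, and 1/<k> is square summable; for s > 1/2
   the space H^s is an algebra. Hence G is locally Lipschitz on X^s, and Picard iteration
   in the ball of radius 2 (|U_0| + |f| + 1) converges on a time interval depending only
   on that radius. The extra 1 in the radius makes the same interval serve all data at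
   distance less than 1; uniqueness and Lipschitz dependence follow by Gronwall. *)

Require Import Defs.
From mathcomp Require Import all_boot all_order all_algebra.
From mathcomp Require Import all_classical all_reals all_analysis.
From mathcomp Require Import measurable_realfun complex ring lra zify.
Import Order.TTheory GRing.Theory Num.Theory.
Import numFieldNormedType.Exports.
Import Normc.
Set Implicit Arguments. Unset Strict Implicit. Unset Printing Implicit Defensive.
Local Open Scope classical_set_scope.
Local Open Scope ring_scope.

(* all_analysis also exports a [conv], which hides the convolution of Defs. *)
Local Notation conv := Defs.conv.

(** * Sums over the integers *)

Section sums_over_Z.
Context {R : realType}.
Implicit Types g h : int -> R.

(** The limits behind [sumZ] are total, so the norm of a divergent series is still a number and
    carries no information. Estimates are therefore bounds on all partial sums, and convergence and
    the norm are recovered from them afterwards. A window of modes is read as a finite vector of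
    real coordinates ([coord]), so that the triangle inequality, Minkowski's integral inequality and
    lower semicontinuity become facts about finite sums. This replaces Bochner integration and
    completeness of X^s: Duhamel integrals and the Picard limit exist coordinate by coordinate, and
    norm bounds pass to them window by window. In the power u^(p+1) only the last product goes
    through the estimate that loses a derivative; the other p-1 products use the algebra property.
    For p = 1 there are none of these, which is why s >= 0 suffices there. Lipschitz dependence has
    to hold for arbitrary mild solutions of nearby data. Uniqueness identifies them with Picard
    solutions, which puts them all in one ball. *)

Definition window (N : nat) : seq int := [seq i%:Z - N%:Z | i <- iota 0 N.*2.+1].

(** Seen as duplicate-free lists, windows can be compared by inclusion and reindexed by
    permutation. *)
Lemma psumZE g N : psumZ g N = \sum_(k <- window N) g k.
Proof.
rewrite /psumZ /window big_map -[in RHS](subn0 N.*2.+1).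
by rewrite -/(index_iota 0 N.*2.+1) big_mkord.
Qed.

Lemma window_uniq N : uniq (window N).
Proof. by rewrite map_inj_uniq ?iota_uniq// => i j; lia. Qed.

Lemma mem_window N (k : int) : (k \in window N) = (`|k|%N <= N)%N.
Proof.
apply/mapP/idP => [[m]|kN]; first by rewrite mem_iota => mN ->; lia.
exists (absz ((k : int) + N%:Z)); last by lia.
by rewrite mem_iota; lia.
Qed.

Lemma psumZD g h N : psumZ (fun k => g k + h k) N = psumZ g N + psumZ h N.
Proof. by rewrite !psumZE big_split. Qed.

Lemma psumZM (c : R) g N : psumZ (fun k => c * g k) N = c * psumZ g N.
Proof. by rewrite !psumZE mulr_sumr. Qed.

Lemma psumZN g N : psumZ (fun k => - g k) N = - psumZ g N.
Proof. by rewrite !psumZE sumrN. Qed.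

Lemma le_psumZ g h N : (forall k, g k <= h k) -> psumZ g N <= psumZ h N.
Proof. by move=> gh; rewrite !psumZE ler_sum. Qed.

Lemma psumZ_ge0 g N : (forall k, 0 <= g k) -> 0 <= psumZ g N.
Proof. by move=> g0; rewrite psumZE sumr_ge0. Qed.

Lemma sum_subset_le g (r r' : seq int) : (forall k, 0 <= g k) ->
  uniq r -> uniq r' -> {subset r <= r'} ->
  \sum_(k <- r) g k <= \sum_(k <- r') g k.
Proof.
move=> g0 ur ur' rr'.
rewrite [leRHS](bigID (fun k => k \in r))/= -[leLHS]addr0.
apply: lerD; last by rewrite sumr_ge0.
rewrite -[leRHS]big_filter le_eqVlt; apply/orP; left; apply/eqP.
apply: perm_big; apply: uniq_perm => //; first exact: filter_uniq.
by move=> k; rewrite mem_filter; case: (boolP (k \in r)) => // /rr' ->.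
Qed.

Lemma sum_le_psumZ g M (r : seq int) : (forall k, 0 <= g k) ->
  (forall N, psumZ g N <= M) -> uniq r -> \sum_(k <- r) g k <= M.
Proof.
move=> g0 gM ur; pose N := (\max_(k <- r) `|k|%N)%N.
apply: le_trans (gM N); rewrite psumZE; apply: sum_subset_le => //.
  exact: window_uniq.
by move=> k kr; rewrite mem_window /N; exact: leq_bigmax_seq.
Qed.

(** A shifted and reflected window is not a window, but every finite set of indices lies in a larger
    one. Used with j -> k - j in convolutions. *)
Lemma psumZ_inj_le g M (f : int -> int) N : injective f -> (forall k, 0 <= g k) ->
  (forall N, psumZ g N <= M) -> psumZ (g \o f) N <= M.
Proof.
move=> finj g0 gM; rewrite psumZE -(big_map f predT g).
by apply: sum_le_psumZ => //; rewrite map_inj_uniq// window_uniq.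
Qed.

Lemma term_le_psumZ g M k : (forall k, 0 <= g k) ->
  (forall N, psumZ g N <= M) -> g k <= M.
Proof.
by move=> g0 gM; have := @sum_le_psumZ g M [:: k] g0 gM isT; rewrite big_seq1.
Qed.

Lemma psumZ_nd g : (forall k, 0 <= g k) -> nondecreasing_seq (psumZ g).
Proof.
move=> g0 m n mn; rewrite !psumZE sum_subset_le// ?window_uniq//.
by move=> k; rewrite !mem_window => /leq_trans; apply.
Qed.

Lemma is_cvg_psumZ g M : (forall k, 0 <= g k) -> (forall N, psumZ g N <= M) ->
  cvgn (psumZ g).
Proof.
move=> g0 gM; apply: nondecreasing_is_cvgn; first exact: psumZ_nd.
by exists M => _ [N _ <-].
Qed.

Lemma psumZ_le_sumZ g N : (forall k, 0 <= g k) -> cvgn (psumZ g) ->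
  psumZ g N <= sumZ g.
Proof. by move=> g0 cg; apply: nondecreasing_cvgn_le => //; exact: psumZ_nd. Qed.

Lemma sumZ_le g M : cvgn (psumZ g) -> (forall N, psumZ g N <= M) -> sumZ g <= M.
Proof. by move=> cg gM; apply: limr_le => //; exact: nearW. Qed.

Lemma sumZ_ge0 g : (forall k, 0 <= g k) -> cvgn (psumZ g) -> 0 <= sumZ g.
Proof. by move=> g0 cg; apply: limr_ge => //; apply: nearW => N; exact: psumZ_ge0. Qed.

(** Writing h = (h + g) - g reduces the claim to two nonnegative series with bounded partial
    sums. *)
Lemma is_cvg_psumZ_abs g h M : (forall k, `|h k| <= g k) ->
  (forall N, psumZ g N <= M) -> cvgn (psumZ h).
Proof.
move=> hg gM; have g0 k : 0 <= g k by exact: le_trans (hg k).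
have -> : psumZ h = psumZ (fun k => h k + g k) \- psumZ g.
  by apply/funext => N /=; rewrite psumZD addrK.
apply: is_cvgB; last exact: is_cvg_psumZ gM.
apply: (@is_cvg_psumZ _ (M + M)) => [k|N].
  by move: (hg k); rewrite ler_norml => /andP[]; lra.
rewrite psumZD lerD//; apply: le_trans (gM N); apply: le_psumZ => k.
exact: le_trans (ler_norm _) _.
Qed.

Lemma sumZ_abs_le g h M : (forall k, `|h k| <= g k) ->
  (forall N, psumZ g N <= M) -> `|sumZ h| <= M.
Proof.
move=> hg gM; have ch := is_cvg_psumZ_abs hg gM.
have hM N : `|psumZ h N| <= M.
  apply: le_trans (gM N); rewrite !psumZE; apply: le_trans (ler_norm_sum _ _ _) _.
  by apply: ler_sum.
rewrite ler_norml; apply/andP; split.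
  by apply: limr_ge => //; apply: nearW => N; move: (hM N); rewrite ler_norml => /andP[].
by apply: limr_le => //; apply: nearW => N; move: (hM N); rewrite ler_norml => /andP[].
Qed.

Lemma sumZB g h : cvgn (psumZ g) -> cvgn (psumZ h) ->
  sumZ (fun k => g k - h k) = sumZ g - sumZ h.
Proof.
move=> cg ch; rewrite /sumZ -limB//; congr (lim (_ @ \oo)).
by apply/funext => N; rewrite psumZD psumZN.
Qed.

Lemma sumZD g h : cvgn (psumZ g) -> cvgn (psumZ h) ->
  sumZ (fun k => g k + h k) = sumZ g + sumZ h.
Proof.
move=> cg ch; rewrite /sumZ -limD//; congr (lim (_ @ \oo)).
by apply/funext => N; rewrite psumZD.
Qed.

Lemma sumZN g : cvgn (psumZ g) -> sumZ (fun k => - g k) = - sumZ g.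
Proof.
move=> cg; rewrite /sumZ -limN//; congr (lim (_ @ \oo)).
by apply/funext => N; rewrite psumZN.
Qed.

(** Windows are symmetric about 0; the realness of a convolution rests on this. *)
Lemma psumZ_opp g N : psumZ (fun k => g (- k)) N = psumZ g N.
Proof.
rewrite !psumZE -(big_map -%R predT g); apply: perm_big; apply: uniq_perm.
- by rewrite map_inj_uniq ?window_uniq//; exact: oppr_inj.
- exact: window_uniq.
move=> k; rewrite mem_window; apply/mapP/idP => [[j]|kN].
  by rewrite mem_window => jN ->; lia.
by exists (- k); rewrite ?opprK// mem_window; lia.
Qed.

Lemma sumZ_opp g : sumZ (fun k => g (- k)) = sumZ g.
Proof. by rewrite /sumZ (_ : psumZ _ = psumZ g)//; apply/funext => N; exact: psumZ_opp. Qed.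

End sums_over_Z.

(** * Norms on Fourier coefficients *)

Section finite_l2.
Context {R : realType} {J : Type}.
Implicit Types (r : seq J) (x y : J -> R).

Lemma sum_mul_sqr_le r x y :
  (\sum_(j <- r) x j * y j) ^+ 2 <=
  (\sum_(j <- r) x j ^+ 2) * (\sum_(j <- r) y j ^+ 2).
Proof.
elim: r => [|j r IH]; first by rewrite !big_nil expr0n/= mul0r.
rewrite !big_cons.
set S := \sum_(_ <- _) _ in IH *; set A := \sum_(_ <- _) _ in IH *.
set B := \sum_(_ <- r) y _ ^+ 2 in IH *.
have A0 : 0 <= A by apply: sumr_ge0 => i _; exact: sqr_ge0.
have B0 : 0 <= B by apply: sumr_ge0 => i _; exact: sqr_ge0.
(* Cross term of the inductive step: its square is at most 4 A B (x_j y_j)^2 by induction, and 4 (A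
   y_j^2)(B x_j^2) <= (A y_j^2 + B x_j^2)^2. *)
have : 2 * S * (x j * y j) <= A * y j ^+ 2 + B * x j ^+ 2.
  have T0 : 0 <= A * y j ^+ 2 + B * x j ^+ 2 by rewrite addr_ge0// mulr_ge0// sqr_ge0.
  apply: le_trans (ler_norm _) _; rewrite -(ler_pXn2r (n := 2))// ?nnegrE//.
  rewrite real_normK ?num_real//.
  have := sqr_ge0 (A * y j ^+ 2 - B * x j ^+ 2).
  have : 4 * S ^+ 2 * (x j * y j) ^+ 2 <= 4 * (A * B) * (x j * y j) ^+ 2.
    by rewrite ler_wpM2r ?sqr_ge0// ler_wpM2l.
  nra.
nra.
Qed.

Lemma sum_mul_le r x y (A B : R) : 0 <= A -> 0 <= B ->
  \sum_(j <- r) x j ^+ 2 <= A ^+ 2 -> \sum_(j <- r) y j ^+ 2 <= B ^+ 2 ->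
  \sum_(j <- r) x j * y j <= A * B.
Proof.
move=> A0 B0 xA yB; apply: le_trans (ler_norm _) _.
rewrite -(ler_pXn2r (n := 2))// ?nnegrE ?mulr_ge0// real_normK ?num_real//.
apply: le_trans (sum_mul_sqr_le _ _ _) _; rewrite exprMn.
by apply: ler_pM => //; apply: sumr_ge0 => i _; exact: sqr_ge0.
Qed.

(** The Euclidean triangle inequality in squared form, so that it applies to each window
    directly. *)
Lemma sum_sqrD_le r x y (A B : R) : 0 <= A -> 0 <= B ->
  \sum_(j <- r) x j ^+ 2 <= A ^+ 2 -> \sum_(j <- r) y j ^+ 2 <= B ^+ 2 ->
  \sum_(j <- r) (x j + y j) ^+ 2 <= (A + B) ^+ 2.
Proof.
move=> A0 B0 xA yB.
have -> : \sum_(j <- r) (x j + y j) ^+ 2 = \sum_(j <- r) x j ^+ 2 +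
    2 * \sum_(j <- r) x j * y j + \sum_(j <- r) y j ^+ 2.
  rewrite mulr_sumr -!big_split/=; apply: eq_bigr => j _; ring.
have := sum_mul_le A0 B0 xA yB; nra.
Qed.

End finite_l2.

Section complex_facts.
Context {R : realType}.
Implicit Types z w : R[i].

Lemma cReD z w : complex.Re (z + w) = complex.Re z + complex.Re w.
Proof. by case: z w => [a b] [c d]. Qed.
Lemma cImD z w : complex.Im (z + w) = complex.Im z + complex.Im w.
Proof. by case: z w => [a b] [c d]. Qed.
Lemma cReB z w : complex.Re (z - w) = complex.Re z - complex.Re w.
Proof. by case: z w => [a b] [c d]. Qed.
Lemma cImB z w : complex.Im (z - w) = complex.Im z - complex.Im w.
Proof. by case: z w => [a b] [c d]. Qed.
Lemma cReM z w : complex.Re (z * w) =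
  complex.Re z * complex.Re w - complex.Im z * complex.Im w.
Proof. by case: z w => [a b] [c d]. Qed.
Lemma cImM z w : complex.Im (z * w) =
  complex.Re z * complex.Im w + complex.Im z * complex.Re w.
Proof. by case: z w => [a b] [c d]. Qed.

Lemma complexP z w : complex.Re z = complex.Re w -> complex.Im z = complex.Im w -> z = w.
Proof. by case: z w => [a b] [c d] /= -> ->. Qed.

Lemma cabs2_normc z : cabs2 z = normc z ^+ 2.
Proof. by case: z => a b; rewrite /cabs2/= sqr_sqrtr// addr_ge0 ?sqr_ge0. Qed.

Lemma normc_ge0 z : 0 <= normc z.
Proof. by case: z => a b; exact: sqrtr_ge0. Qed.

Lemma normc_zero : normc (0 : R[i]) = 0. Proof. exact: normc0. Qed.

Lemma normc_Re z : `|complex.Re z| <= normc z.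
Proof.
case: z => a b /=; rewrite -sqrtr_sqr ler_sqrt ?addr_ge0 ?sqr_ge0//.
by rewrite lerDl sqr_ge0.
Qed.

Lemma normc_Im z : `|complex.Im z| <= normc z.
Proof.
case: z => a b /=; rewrite -sqrtr_sqr ler_sqrt ?addr_ge0 ?sqr_ge0//.
by rewrite lerDr sqr_ge0.
Qed.

Lemma normc_ReIm z : normc z <= `|complex.Re z| + `|complex.Im z|.
Proof.
case: z => a b /=; rewrite -(ler_pXn2r (n := 2)) ?nnegrE ?sqrtr_ge0 ?addr_ge0//.
rewrite sqr_sqrtr ?addr_ge0 ?sqr_ge0// sqrrD !real_normK ?num_real//.
by rewrite -addrA lerD2l lerDr mulrn_wge0// mulr_ge0.
Qed.

Lemma normc_real (x : R) : normc x%:C%C = `|x|.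
Proof. by rewrite /= expr0n/= addr0 sqrtr_sqr. Qed.

Lemma DxE k : @Dx R k = Complex 0 k%:~R.
Proof. rewrite /Dx /Num.imaginary /=; by simpc. Qed.

End complex_facts.

(** * Weights of the Sobolev norms *)

Section weights.
Context {R : realType}.
Implicit Types (s : R) (k : int).

Lemma bracket_ge1 k : 1 <= 1 + k%:~R ^+ 2 :> R.
Proof. by rewrite lerDl sqr_ge0. Qed.

Lemma bracket_gt0 k : 0 < 1 + k%:~R ^+ 2 :> R.
Proof. exact: lt_le_trans (bracket_ge1 k). Qed.

Lemma bracket_ge0 k : 0 <= 1 + k%:~R ^+ 2 :> R.
Proof. exact/ltW/bracket_gt0. Qed.

Lemma wgt_gt0 s k : 0 < wgt s k.
Proof. by rewrite powR_gt0// bracket_gt0. Qed.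

Lemma wgt_pred s k : wgt s k = (1 + k%:~R ^+ 2) * wgt (s - 1) k.
Proof.
rewrite /wgt -{2}(@powRr1 R (1 + k%:~R ^+ 2)) ?ltW ?bracket_gt0//.
rewrite -powRD; first by congr (_ `^ _); ring.
by apply/implyP => _; rewrite gt_eqF ?bracket_gt0.
Qed.

Lemma wgt_opp s k : wgt s (- k) = wgt s k.
Proof. by rewrite /wgt mulrNz sqrrN. Qed.

(** This is <k>^s, the factor on a coefficient; [wgt s k] is <k>^(2s), the factor on its square. *)
Definition swgt s k : R := Num.sqrt (wgt s k).

Lemma swgt_gt0 s k : 0 < swgt s k.
Proof. by rewrite sqrtr_gt0 wgt_gt0. Qed.

Lemma swgt_ge0 s k : 0 <= swgt s k. Proof. exact: sqrtr_ge0. Qed.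

Lemma sqr_swgt s k : swgt s k ^+ 2 = wgt s k.
Proof. by rewrite sqr_sqrtr// ltW// wgt_gt0. Qed.

(** The Japanese bracket <k>. *)
Definition jap k : R := Num.sqrt (1 + k%:~R ^+ 2).

Lemma jap_gt0 k : 0 < jap k.
Proof. by rewrite sqrtr_gt0 bracket_gt0. Qed.

Lemma sqr_jap k : jap k ^+ 2 = 1 + k%:~R ^+ 2.
Proof. by rewrite sqr_sqrtr// ltW// bracket_gt0. Qed.

Lemma swgt_pred s k : swgt s k = jap k * swgt (s - 1) k.
Proof. by rewrite /swgt wgt_pred sqrtrM// ltW// bracket_gt0. Qed.

End weights.

(** * Norm bounds expressed through partial sums *)

Section Sobolev_bounds.
Context {R : realType}.
Implicit Types (s M : R) (a b : fseq R) (U V : state R).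

Lemma HtermE s a k : Hterm s a k = (swgt s k * normc (a k)) ^+ 2.
Proof. by rewrite /Hterm exprMn sqr_swgt cabs2_normc. Qed.

Lemma Hterm_ge0 s a k : 0 <= Hterm s a k.
Proof. by rewrite HtermE sqr_ge0. Qed.

Definition Xterm s U k := Hterm s U.1 k + Hterm (s - 1) U.2 k.

Lemma Xterm_ge0 s U k : 0 <= Xterm s U k.
Proof. by rewrite addr_ge0// Hterm_ge0. Qed.

(* [XB s U M] is the bound ||U||_{X^s} <= M, meaningful without knowing in
   advance that the series defining the norm converges. *)
Definition XB s U M := 0 <= M /\ forall N, psumZ (Xterm s U) N <= M ^+ 2.
Definition HB s a M := 0 <= M /\ forall N, psumZ (Hterm s a) N <= M ^+ 2.

(** Embeds H^s in X^s, so that monotonicity and the triangle inequality for [HB] are read off from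
    those for [XB]. *)
Definition fst_state a : state R := (a, fun=> 0).

Lemma Xterm_fst_state s a k : Xterm s (fst_state a) k = Hterm s a k.
Proof.
rewrite /Xterm [X in _ + X](_ : _ = 0) ?addr0//.
by rewrite HtermE (_ : normc _ = 0) ?mulr0 ?expr0n//; exact: normc_zero.
Qed.

Lemma XB_fst_state s a M : XB s (fst_state a) M <-> HB s a M.
Proof.
have e : psumZ (Xterm s (fst_state a)) = psumZ (Hterm s a).
  by congr psumZ; apply/funext => k; exact: Xterm_fst_state.
by rewrite /XB /HB e.
Qed.

Definition addX U V : state R := (fun k => U.1 k + V.1 k, fun k => U.2 k + V.2 k).

(** Weighted real and imaginary parts: each is a real linear functional of norm at most 1 on X^s,
    and their squares add up to the squared norm. Every second index above 2 means the imaginary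
    part of the second component. *)
Definition coord s U (j : int * nat) : R :=
  match j.2 with
  | 0%N => swgt s j.1 * complex.Re (U.1 j.1)
  | 1%N => swgt s j.1 * complex.Im (U.1 j.1)
  | 2%N => swgt (s - 1) j.1 * complex.Re (U.2 j.1)
  | _ => swgt (s - 1) j.1 * complex.Im (U.2 j.1)
  end.

Definition coords (N : nat) : seq (int * nat) :=
  [seq (k, i) | k <- window N, i <- iota 0 4].

Lemma psumZ_coord s U N :
  psumZ (Xterm s U) N = \sum_(j <- coords N) coord s U j ^+ 2.
Proof.
rewrite psumZE /coords big_allpairs; apply: eq_bigr => k _.
rewrite /= !big_cons big_nil /coord/= !exprMn !sqr_swgt /Xterm /Hterm /cabs2; ring.
Qed.

Lemma coordD s U V j : coord s (addX U V) j = coord s U j + coord s V j.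
Proof. by case: j => k [|[|[|n]]]; rewrite /coord/= ?cReD ?cImD mulrDr. Qed.

Lemma coordB s U V j : coord s (subX U V) j = coord s U j - coord s V j.
Proof. by case: j => k [|[|[|n]]]; rewrite /coord/= /subS ?cReB ?cImB mulrBr. Qed.

Lemma le_XB s U M M' : XB s U M -> M <= M' -> XB s U M'.
Proof.
move=> [M0 UM] MM'; split=> [|N]; first exact: le_trans MM'.
by rewrite (le_trans (UM N))// ler_pXn2r// nnegrE// (le_trans M0).
Qed.

Lemma XB_add s U V M M' : XB s U M -> XB s V M' -> XB s (addX U V) (M + M').
Proof.
move=> [M0 UM] [M0' VM]; split=> [|N]; first exact: addr_ge0.
rewrite psumZ_coord; under eq_bigr do rewrite coordD.
by apply: sum_sqrD_le => //; rewrite -psumZ_coord.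
Qed.

Lemma XB_sub s U V M M' : XB s U M -> XB s V M' -> XB s (subX U V) (M + M').
Proof.
move=> [M0 UM] [M0' VM]; split=> [|N]; first exact: addr_ge0.
rewrite psumZ_coord; under eq_bigr do rewrite coordB.
apply: sum_sqrD_le => //; first by rewrite -psumZ_coord.
by under eq_bigr do rewrite sqrrN; rewrite -psumZ_coord.
Qed.

Lemma XB_subC s U V M : XB s (subX U V) M -> XB s (subX V U) M.
Proof.
move=> [M0 UV]; split=> // N; rewrite (le_trans _ (UV N))// !psumZ_coord le_eqVlt.
by apply/orP; left; apply/eqP/eq_bigr => j _; rewrite !coordB -sqrrN opprB.
Qed.

Lemma XB_le_sub s U V M D : XB s V M -> XB s (subX U V) D -> XB s U (D + M).
Proof.
move=> VM UV; have := XB_add UV VM; congr (XB s _ _).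
case: U UV => u v _; rewrite /addX /subX/= /subS; congr (_, _);
  by apply/funext => k; rewrite subrK.
Qed.

Lemma XB_trans s U V W M M' :
  XB s (subX U V) M -> XB s (subX V W) M' -> XB s (subX U W) (M + M').
Proof.
move=> UV VW; have := XB_add UV VW; congr (XB s _ _).
rewrite /addX /subX/= /subS; congr (_, _); by apply/funext => k; rewrite addrA subrK.
Qed.

Lemma le_HB s a M M' : HB s a M -> M <= M' -> HB s a M'.
Proof. by move=> /XB_fst_state aM /(le_XB aM)/XB_fst_state. Qed.

Lemma HB_sub s a b M M' : HB s a M -> HB s b M' -> HB s (subS a b) (M + M').
Proof.
move=> /XB_fst_state aM /XB_fst_state bM; apply/XB_fst_state.
have := XB_sub aM bM; congr (XB s _ _); congr (_, _).
by apply/funext => k; rewrite /subS/= subr0.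
Qed.

Lemma HB_add s a b M M' : HB s a M -> HB s b M' ->
  HB s (fun k => a k + b k) (M + M').
Proof.
move=> /XB_fst_state aM /XB_fst_state bM; apply/XB_fst_state.
have := XB_add aM bM; congr (XB s _ _); congr (_, _).
by apply/funext => k; rewrite /= addr0.
Qed.

Lemma XB_HB s U M : XB s U M -> HB s U.1 M.
Proof.
move=> [M0 UM]; split=> // N; rewrite (le_trans _ (UM N))// le_psumZ// => k.
by rewrite lerDl Hterm_ge0.
Qed.

Lemma HB_mode s a M k : HB s a M -> swgt s k * normc (a k) <= M.
Proof.
move=> [M0 aM]; rewrite -(ler_pXn2r (n := 2)) ?nnegrE ?mulr_ge0 ?normc_ge0 ?swgt_ge0//.
rewrite -HtermE; apply: (@term_le_psumZ _ (Hterm s a) (M ^+ 2) k _ aM); exact: Hterm_ge0.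
Qed.

Lemma XB_mode1 s U M k : XB s U M -> normc (U.1 k) <= (swgt s k)^-1 * M.
Proof.
by move=> /XB_HB/HB_mode => /(_ k); rewrite ler_pdivlMl ?swgt_gt0.
Qed.

Lemma XB_mode2 s U M k : XB s U M -> normc (U.2 k) <= (swgt (s - 1) k)^-1 * M.
Proof.
move=> [M0 UM]; rewrite ler_pdivlMl ?swgt_gt0//; apply: HB_mode; split=> // N.
by rewrite (le_trans _ (UM N))// le_psumZ// => i; rewrite lerDr Hterm_ge0.
Qed.

Lemma coord_le s U M j : XB s U M -> `|coord s U j| <= M.
Proof.
move=> UM; case: j => k i.
have h1 := XB_mode1 k UM; have h2 := XB_mode2 k UM.
rewrite ler_pdivlMl ?swgt_gt0// in h1; rewrite ler_pdivlMl ?swgt_gt0// in h2.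
have p1 := swgt_gt0 s k; have p2 := swgt_gt0 (s - 1) k.
rewrite /coord/=; case: i => [|[|[|i]]]; rewrite normrM gtr0_norm//;
  [apply: le_trans h1|apply: le_trans h1|apply: le_trans h2|apply: le_trans h2];
  by rewrite ler_pM2l// (normc_Re, normc_Im).
Qed.

Lemma HB_cvg s a M : HB s a M -> cvgn (psumZ (Hterm s a)).
Proof. by move=> [M0 aM]; apply: is_cvg_psumZ aM; exact: Hterm_ge0. Qed.

Lemma cvg_HB s a : cvgn (psumZ (Hterm s a)) -> HB s a (Hnorm s a).
Proof.
move=> ca; have a0 := Hterm_ge0 s a; split=> [|N]; first exact: sqrtr_ge0.
by rewrite sqr_sqrtr ?sumZ_ge0//; exact: psumZ_le_sumZ.
Qed.

Lemma HB_Hnorm s a M : HB s a M -> Hnorm s a <= M.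
Proof.
move=> aM; have ca := HB_cvg aM; case: aM => M0 aM.
rewrite -(ler_pXn2r (n := 2)) ?nnegrE ?sqrtr_ge0//.
by rewrite sqr_sqrtr ?sumZ_ge0 ?sumZ_le//; exact: Hterm_ge0.
Qed.

Definition real_state U := realseq U.1 /\ realseq U.2.

Lemma inX_real s U : inX s U -> real_state U.
Proof. by move=> [[? _] [? _]]. Qed.

Lemma inX_XB s U : inX s U -> XB s U (Xnorm s U).
Proof.
move=> [[_ /cvg_HB [_ c1]] [_ /cvg_HB[_ c2]]]; split=> [|N]; first exact: sqrtr_ge0.
by rewrite sqr_sqrtr ?addr_ge0 ?sqr_ge0// psumZD lerD.
Qed.

Lemma XB_cvg s U M : XB s U M ->
  cvgn (psumZ (Hterm s U.1)) /\ cvgn (psumZ (Hterm (s - 1) U.2)).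
Proof.
move=> [M0 UM]; split; apply: (@is_cvg_psumZ _ _ (M ^+ 2)) => [k|N];
  rewrite ?Hterm_ge0 ?(le_trans _ (UM N)) ?le_psumZ// => k; by rewrite (lerDl, lerDr) Hterm_ge0.
Qed.

Lemma XB_inX s U M : real_state U -> XB s U M -> inX s U.
Proof. by move=> [? ?] /XB_cvg[? ?]; split; split. Qed.

Lemma XB_Xnorm s U M : XB s U M -> Xnorm s U <= M.
Proof.
move=> UM; have [c1 c2] := XB_cvg UM; case: UM => M0 UM.
rewrite -(ler_pXn2r (n := 2)) ?nnegrE ?sqrtr_ge0//.
rewrite sqr_sqrtr ?addr_ge0 ?sqr_ge0// !sqr_sqrtr ?sumZ_ge0//; try exact: Hterm_ge0.
rewrite -sumZD//; apply: sumZ_le => //.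
by apply: is_cvg_psumZ UM; exact: Xterm_ge0.
Qed.

Lemma Xnorm_ge0 s U : 0 <= Xnorm s U. Proof. exact: sqrtr_ge0. Qed.

Lemma real_state_sub U V : real_state U -> real_state V -> real_state (subX U V).
Proof.
move=> [u1 u2] [v1 v2]; split=> k; rewrite /= /subS ?u1 ?u2 ?v1 ?v2;
  by rewrite -raddfB.
Qed.

Lemma real_state_add U V : real_state U -> real_state V -> real_state (addX U V).
Proof.
move=> [u1 u2] [v1 v2]; split=> k; rewrite /= ?u1 ?u2 ?v1 ?v2;
  by rewrite -raddfD.
Qed.

Lemma inX_sub s U V : inX s U -> inX s V -> inX s (subX U V).
Proof.
move=> hU hV; apply: XB_inX (XB_sub (inX_XB hU) (inX_XB hV)).
by apply: real_state_sub; apply: inX_real; eassumption.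
Qed.

(* Fatou: the norm is lower semicontinuous for modewise convergence. *)
Lemma XB_lim s (Un : nat -> state R) U M : 0 <= M ->
  (\forall n \near \oo, XB s (Un n) M) ->
  (forall j, coord s (Un n) j @[n --> \oo] --> coord s U j) -> XB s U M.
Proof.
move=> M0 UnM cU; split=> // N; rewrite psumZ_coord.
have h : \sum_(j <- coords N) coord s (Un n) j ^+ 2 @[n --> \oo] -->
    \sum_(j <- coords N) coord s U j ^+ 2.
  apply: cvg_big => [|j _]; first exact: add_continuous.
  by rewrite expr2; under eq_fun do rewrite expr2; apply: cvgM; exact: cU.
rewrite -(cvg_lim _ h)//; apply: limr_le; first by apply/cvg_ex; eexists; exact: h.
by near=> n; rewrite -psumZ_coord; have [_] : XB s (Un n) M by near: n.
Unshelve. all: by end_near. Qed.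

End Sobolev_bounds.

(** * Products of functions in Sobolev spaces *)

Section weight_sums.
Context {R : realType}.
Implicit Types (s : R) (g : int -> R).

Lemma psumZS g N : psumZ g N.+1 = g N.+1%:Z + (g (- N.+1%:Z) + psumZ g N).
Proof.
rewrite !psumZE.
transitivity (\sum_(k <- [:: N.+1%:Z, - N.+1%:Z & window N]) g k); last by rewrite !big_cons.
apply: perm_big; apply: uniq_perm.
- exact: window_uniq.
- rewrite 2!cons_uniq window_uniq in_cons !mem_window andbT negb_or.
  by apply/andP; split; [apply/andP; split|]; lia.
- by move=> k; rewrite [RHS]in_cons [X in _ || X]in_cons !mem_window; lia.
Qed.

Lemma psumZ_even_le g (N : nat) : (forall k, g (- k) = g k) ->
  psumZ g N = g 0 + 2 * \sum_(1 <= n < N.+1) g n%:Z.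
Proof.
move=> ge; elim: N => [|N IH].
  by rewrite big_geq// psumZE/= big_cons big_nil subr0 mulr0.
by rewrite psumZS IH ge [in RHS]big_nat_recr//=; ring.
Qed.

(** Cauchy condensation: the block from 2^m to 2^(m+1) has 2^m terms, each at most f(2^m). The bound
    is the exact geometric partial sum, since the full sum 1/(1-r) would not carry the induction. *)
Lemma dyadic_sum_le (f : nat -> R) (r : R) :
  0 < r < 1 -> (forall m n, (m <= n)%N -> f n <= f m) ->
  (forall m, 2 ^+ m * f (2 ^ m)%N <= r ^+ m) ->
  forall m, \sum_(1 <= n < 2 ^ m) f n <= (1 - r)^-1 * (1 - r ^+ m).
Proof.
move=> /andP[r0 r1] fd fr; elim=> [|m IH].
  by rewrite big_geq// expr0 subrr mulr0.
have m0 : (0 < 2 ^ m)%N by rewrite expn_gt0.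
have mm : (2 ^ m <= 2 ^ m.+1)%N by rewrite leq_exp2l.
rewrite (big_cat_nat m0 mm)/=.
have h : \sum_(2 ^ m <= n < 2 ^ m.+1) f n <= r ^+ m.
  apply: le_trans (fr m); apply: le_trans.
    rewrite big_nat_cond; apply: ler_sum => n /andP[/andP[mn _] _]; exact: fd mn.
  by rewrite -big_nat_cond big_const_nat iter_addr_0 expnS mul2n -addnn addnK
    -[f _ *+ _]mulr_natl natrX.
apply: le_trans (lerD IH h) _.
have r1' : 0 < 1 - r by rewrite subr_gt0.
rewrite -(ler_pM2l r1') mulrDr !mulVKf ?gt_eqF// exprS; nra.
Qed.

Lemma wgt_nat_le s (m n : nat) : 0 <= s -> (m <= n)%N ->
  (wgt s n%:Z)^-1 <= (wgt s m%:Z)^-1.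
Proof.
move=> s0 mn; rewrite lef_pV2 ?posrE ?wgt_gt0// /wgt.
apply: ge0_ler_powR; rewrite ?nnegrE ?bracket_ge0//.
by rewrite lerD2l ler_sqr ?nnegrE ?ler0z// ler_int.
Qed.

Lemma wgt_dyadic_le s m : 0 <= s ->
  2 ^+ m * (wgt s (2 ^ m)%N%:Z)^-1 <= (2 `^ (1 - 2 * s)) ^+ m :> R.
Proof.
move=> s0; rewrite ler_pdivrMr ?wgt_gt0//.
have h2 : (0 : R) < 2 ^+ m by rewrite exprn_gt0.
(* With 2^m split as 2^(m(1-2s)) times (4^m)^s, only 4^m <= 1 + 4^m is left. *)
have e : 2 ^+ m = (2 `^ (1 - 2 * s)) ^+ m * ((2 ^+ m) ^+ 2) `^ s :> R.
  rewrite -!powR_mulrn ?powR_ge0// -!powRrM -powRD; last by rewrite pnatr_eq0 implybT.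
  by congr (_ `^ _); ring.
rewrite [leLHS]e ler_pM2l ?exprn_gt0 ?powR_gt0// /wgt.
apply: ge0_ler_powR; rewrite ?nnegrE ?sqr_ge0 ?bracket_ge0//.
by rewrite -pmulrn natrX lerDr.
Qed.

Lemma wgt_summable s : 2^-1 < s ->
  exists2 C : R, 0 <= C & forall N, psumZ (fun k => (wgt s k)^-1) N <= C.
Proof.
move=> s2; have s0 : 0 <= s by apply: le_trans (ltW s2); rewrite invr_ge0.
(* The condensation ratio, below 1 exactly when s > 1/2. *)
pose r : R := 2 `^ (1 - 2 * s).
have r1 : 0 < r < 1.
  rewrite powR_gt0//= /r -[ltRHS](powRr0 2) /powR pnatr_eq0/= ltr_expR mul0r.
  by rewrite pmulr_llt0 ?ln_gt0 ?ltr1n//; lra.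
have /andP[r0 r1'] := r1.
have rr : 0 <= (1 - r)^-1 by rewrite invr_ge0 subr_ge0 ltW.
(* The mode 0 contributes 1, and the two signs contribute equal sums. *)
exists (1 + 2 * (1 - r)^-1); first by rewrite addr_ge0// mulr_ge0.
move=> N; rewrite psumZ_even_le => [|k]; last by rewrite wgt_opp.
apply: lerD; first by rewrite /wgt expr0n/= addr0 powR1 invr1.
rewrite ler_pM2l//.
have := @dyadic_sum_le (fun n => (wgt s n%:Z)^-1) r r1 (fun m n => wgt_nat_le s0)
  (fun m => wgt_dyadic_le m s0) N.+1.
(* The sum up to N is extended by nonnegative terms to the dyadic end point 2^(N+1). *)
have hN : (N.+1 <= 2 ^ N.+1)%N by rewrite ltnW// ltn_expl.
rewrite (big_cat_nat (_ : (1 <= N.+1)%N) hN)//=.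
have : 0 <= \sum_(N.+1 <= n < 2 ^ N.+1) (wgt s n%:Z)^-1.
  by apply: sumr_ge0 => n _; rewrite invr_ge0 ltW ?wgt_gt0.
have : (1 - r)^-1 * (1 - r ^+ N.+1) <= (1 - r)^-1.
  by rewrite ler_piMr// lerBlDr lerDl exprn_ge0// ltW.
lra.
Qed.

Lemma bracket_split (j k : int) :
  (1 + k%:~R ^+ 2 : R) <= 2 * ((1 + j%:~R ^+ 2) * (1 + (k - j)%:~R ^+ 2)).
Proof.
have -> : (k%:~R : R) = j%:~R + (k - j)%:~R by rewrite -intrD addrC subrK.
move: (j%:~R : R) ((k - j)%:~R : R) => x y.
have := sqr_ge0 (x - y); have := sqr_ge0 (x * y); nra.
Qed.

Lemma wgt_split_mul s (j k : int) : 0 <= s ->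
  wgt s k <= 2 `^ s * (wgt s j * wgt s (k - j)).
Proof.
move=> s0; have b0 i : (0 : R) <= 1 + i%:~R ^+ 2 by exact: ltW (bracket_gt0 i).
rewrite /wgt -!powRM ?mulr_ge0//; apply: ge0_ler_powR; rewrite ?nnegrE ?mulr_ge0//.
exact: bracket_split.
Qed.

(** The larger of |j| and |k-j| is at least |k|/2. Divided by w_j w_(k-j), the bound becomes a sum
    of 1/w_j and 1/w_(k-j), which is summable in j uniformly in k when s > 1/2. *)
Lemma wgt_split_add s (j k : int) : 0 <= s ->
  wgt s k <= 4 `^ s * (wgt s j + wgt s (k - j)).
Proof.
move=> s0; have b0 i : (0 : R) <= 1 + i%:~R ^+ 2 by exact: ltW (bracket_gt0 i).
pose m := Num.max (1 + j%:~R ^+ 2) (1 + (k - j)%:~R ^+ 2) : R.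
have jm : 1 + j%:~R ^+ 2 <= m by rewrite le_max lexx.
have lm : 1 + (k - j)%:~R ^+ 2 <= m by rewrite le_max lexx orbT.
have m0 : 0 <= m by exact: le_trans jm.
apply: (@le_trans _ _ (4 `^ s * m `^ s)).
  rewrite -powRM// /wgt; apply: ge0_ler_powR; rewrite ?nnegrE ?mulr_ge0//.
  have e : (k%:~R : R) = j%:~R + (k - j)%:~R by rewrite -intrD addrC subrK.
  move: jm lm; rewrite e; move: (j%:~R : R) ((k - j)%:~R : R) => x y.
  have := sqr_ge0 (x - y); nra.
rewrite ler_pM2l ?powR_gt0// /m /wgt maxEle; case: ifP => _.
  by rewrite lerDr powR_ge0.
by rewrite lerDl powR_ge0.
Qed.

End weight_sums.

(** * Convolution estimates *)

Section convolution.
Context {R : realType}.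
Implicit Types (s A B M D : R) (a b c d : fseq R).

Definition cabs_sum (g : int -> R[i]) M := forall N, psumZ (fun k => normc (g k)) N <= M.

Lemma cabs_sum_cvg (g : int -> R[i]) M : cabs_sum g M ->
  cvgn (psumZ (fun k => complex.Re (g k))) /\ cvgn (psumZ (fun k => complex.Im (g k))).
Proof.
by move=> gM; split; apply: (is_cvg_psumZ_abs _ gM) => k; [exact: normc_Re|exact: normc_Im].
Qed.

(** The factor 2 comes from bounding the real and imaginary sums separately. *)
Lemma csumZ_le (g : int -> R[i]) M : cabs_sum g M -> normc (csumZ g) <= 2 * M.
Proof.
move=> gM; apply: le_trans (normc_ReIm _) _; rewrite mulr2n mulrDl mul1r.
by apply: lerD; apply: (sumZ_abs_le _ gM) => k; [exact: normc_Re|exact: normc_Im].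
Qed.

Lemma csumZB (g h : int -> R[i]) M M' : cabs_sum g M -> cabs_sum h M' ->
  csumZ (fun k => g k - h k) = csumZ g - csumZ h.
Proof.
move=> /cabs_sum_cvg[g1 g2] /cabs_sum_cvg[h1 h2]; rewrite /csumZ; apply: complexP => /=.
  by rewrite -sumZB//; congr sumZ; apply/funext => k; rewrite cReB.
by rewrite -sumZB//; congr sumZ; apply/funext => k; rewrite cImB.
Qed.

(** Cauchy-Schwarz, where the second factor is reindexed by the injection j -> k - j. *)
Lemma mode_prod_sum_le s a b A B k N : HB s a A -> HB s b B ->
  psumZ (fun j => (swgt s j * normc (a j)) * (swgt s (k - j) * normc (b (k - j)))) N
    <= A * B.
Proof.
move=> [A0 aA] [B0 bB]; rewrite psumZE; apply: sum_mul_le => //.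
  by have := aA N; rewrite psumZE; under eq_bigr do rewrite HtermE.
under eq_bigr do rewrite -HtermE.
rewrite -psumZE; apply: (@psumZ_inj_le _ (Hterm s b) _ (fun j => k - j)) => //.
  by move=> i j /addrI/oppr_inj.
by move=> j; exact: Hterm_ge0.
Qed.

Lemma swgt_split_mul s j k : 0 <= s ->
  swgt s k <= Num.sqrt (2 `^ s) * (swgt s j * swgt s (k - j)) :> R.
Proof.
move=> s0; have w0 i : 0 <= wgt s i := ltW (wgt_gt0 s i).
rewrite /swgt -sqrtrM// -sqrtrM ?powR_ge0// ler_sqrt ?mulr_ge0 ?powR_ge0//.
exact: wgt_split_mul.
Qed.

(** Absolute convergence serves twice: it bounds each coefficient of the product, and it licenses
    splitting the sums in [convB]. *)
Lemma conv_abs_sum s a b A B k : 0 <= s -> HB s a A -> HB s b B ->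
  cabs_sum (fun j => a j * b (k - j)) ((swgt s k)^-1 * (Num.sqrt (2 `^ s) * (A * B))).
Proof.
move=> s0 aA bB N; rewrite ler_pdivlMl ?swgt_gt0// -psumZM.
apply: (@le_trans _ _ (Num.sqrt (2 `^ s) * psumZ (fun j => (swgt s j * normc (a j)) *
    (swgt s (k - j) * normc (b (k - j)))) N)); last first.
  by rewrite ler_wpM2l ?sqrtr_ge0//; exact: mode_prod_sum_le.
rewrite -psumZM; apply: le_psumZ => j; rewrite normcM mulrACA [leRHS]mulrA.
by rewrite ler_wpM2r ?mulr_ge0 ?normc_ge0//; exact: swgt_split_mul.
Qed.

(** The product rule ab - cd = (a - c)b + c(b - d), from which all Lipschitz estimates for powers
    follow. *)
Lemma convB s a b c d A B : 0 <= s -> HB s a A -> HB s b B -> HB s c A -> HB s d B ->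
  subS (conv a b) (conv c d) =
  (fun k => conv (subS a c) b k + conv c (subS b d) k).
Proof.
move=> s0 aA bB cA dB; apply/funext => k; rewrite /subS /conv.
have e1 : csumZ (fun j => (a j - c j) * b (k - j)) =
    csumZ (fun j => a j * b (k - j)) - csumZ (fun j => c j * b (k - j)).
  rewrite -(csumZB (conv_abs_sum k s0 aA bB) (conv_abs_sum k s0 cA bB)).
  by congr csumZ; apply/funext => j; rewrite mulrBl.
have e2 : csumZ (fun j => c j * (b (k - j) - d (k - j))) =
    csumZ (fun j => c j * b (k - j)) - csumZ (fun j => c j * d (k - j)).
  rewrite -(csumZB (conv_abs_sum k s0 cA bB) (conv_abs_sum k s0 cA dB)).
  by congr csumZ; apply/funext => j; rewrite mulrBr.
by rewrite e1 e2 addrA subrK.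
Qed.

Lemma realseq_conv s a b A B : 0 <= s -> HB s a A -> HB s b B ->
  realseq a -> realseq b -> realseq (conv a b).
Proof.
move=> s0 aA bB ra rb k.
have [_ c2] := cabs_sum_cvg (conv_abs_sum k s0 aA bB).
(* The coefficient at -k is summed over -j; conjugation then acts term by term. *)
have e j : a (- j) * b (- k - - j) = (a j * b (k - j))^*%C.
  by rewrite rmorphM/= ra -opprD rb.
rewrite /conv /csumZ; apply: complexP => /=.
  rewrite -[LHS]sumZ_opp; congr sumZ; apply/funext => j.
  by rewrite e; case: (_ * _).
rewrite -[LHS]sumZ_opp -sumZN//; congr sumZ; apply/funext => j.
by rewrite e; case: (_ * _).
Qed.

(* The coefficients of the product, weighted by <k>^s, are bounded for every s >= 0,
   and 1/(1+k^2) is summable. *)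
Lemma conv_HB_pred s : 0 <= s -> exists2 K : R, 0 <= K &
  forall a b A B, HB s a A -> HB s b B -> HB (s - 1) (conv a b) (K * (A * B)).
Proof.
move=> s0; have [|C C0 hC] := @wgt_summable R 1.
  by rewrite invf_lt1// ltr1n.
(* The factors come from [csumZ_le], from the weight splitting, and from the sum of 1/(1+k^2). *)
exists (2 * Num.sqrt (2 `^ s) * Num.sqrt C).
  by rewrite !mulr_ge0// sqrtr_ge0.
move=> a b A B aA bB.
have A0 := aA.1; have B0 := bB.1.
split=> [|N]; first by rewrite !mulr_ge0// sqrtr_ge0.
(* Q/(1+k^2) dominates the k-th term of the H^(s-1) norm. *)
pose Q := (2 * Num.sqrt (2 `^ s) * (A * B)) ^+ 2.
apply: (@le_trans _ _ (psumZ (fun k => Q * (wgt 1 k)^-1) N)).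
  apply: le_psumZ => k; rewrite ler_pdivlMr ?wgt_gt0//.
  have -> : Hterm (s - 1) (conv a b) k * wgt 1 k = (swgt s k * normc (conv a b k)) ^+ 2.
    rewrite HtermE !exprMn !sqr_swgt (wgt_pred s) /(wgt 1) powRr1 ?bracket_ge0//; ring.
  rewrite ler_pXn2r ?nnegrE ?mulr_ge0 ?swgt_ge0 ?normc_ge0 ?sqrtr_ge0//.
  rewrite -ler_pdivlMl ?swgt_gt0//.
  apply: le_trans (csumZ_le (conv_abs_sum k s0 aA bB)) _.
  by rewrite le_eqVlt; apply/orP; left; apply/eqP; ring.
rewrite psumZM.
have -> : (2 * Num.sqrt (2 `^ s) * Num.sqrt C * (A * B)) ^+ 2 = Q * C.
  by rewrite -[in RHS](sqr_sqrtr C0) /Q; ring.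
by rewrite ler_wpM2l ?sqr_ge0.
Qed.

Lemma cvg_sum_sqr (r : seq int) (P : int -> nat -> R) (p w : int -> R) :
  (forall k, P k n @[n --> \oo] --> p k) ->
  \sum_(k <- r) w k * P k n ^+ 2 @[n --> \oo] --> \sum_(k <- r) w k * p k ^+ 2.
Proof.
move=> Pp; apply: cvg_big => [|k _]; first exact: add_continuous.
apply: cvgMr; rewrite expr2; under eq_fun do rewrite expr2.
by apply: cvgM; exact: Pp.
Qed.

(* Cauchy-Schwarz against the weights 1/(w_j w_(k-j)), whose sum over j is
   O(1/w_k) when s > 1/2. *)
Lemma conv_HB s : 2^-1 < s -> exists2 K : R, 0 <= K &
  forall a b A B, HB s a A -> HB s b B -> HB s (conv a b) (K * (A * B)).
Proof.
move=> s2; have s0 : 0 <= s by apply: le_trans (ltW s2); rewrite invr_ge0.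
have [C C0 hC] := wgt_summable s2.
(* Bounds w_k times the sum over j of 1/(w_j w_(k-j)), uniformly in k ([gam]). *)
pose E := 4 `^ s * (C + C).
have E0 : 0 <= E by rewrite mulr_ge0 ?powR_ge0 ?addr_ge0.
exists (2 * Num.sqrt E); first by rewrite mulr_ge0 ?sqrtr_ge0.
move=> a b A B aA bB; have A0 := aA.1; have B0 := bB.1.
split=> [|N]; first by rewrite !mulr_ge0 ?sqrtr_ge0.
have winv0 k : 0 <= (wgt s k)^-1 :> R by rewrite invr_ge0 ltW ?wgt_gt0.
have kinj k : injective (fun j : int => k - j) by move=> i j /addrI/oppr_inj.
pose g k j := normc (a j * b (k - j)).
pose P k n := psumZ (g k) n.
pose p k := sumZ (g k).
have g0 k j : 0 <= g k j by exact: normc_ge0.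
have Pp k : P k n @[n --> \oo] --> p k.
  have c : cvgn (psumZ (g k)) by exact: is_cvg_psumZ (g0 k) (conv_abs_sum k s0 aA bB).
  exact: c.
have convp k : normc (conv a b k) <= 2 * p k.
  apply: csumZ_le => n; apply: (psumZ_le_sumZ n (g0 k)).
  exact: (is_cvg_psumZ (g0 k) (conv_abs_sum k s0 aA bB)).
have gam k n : wgt s k * psumZ (fun j => (wgt s j)^-1 * (wgt s (k - j))^-1) n <= E.
  rewrite -psumZM; apply: (@le_trans _ _
    (psumZ (fun j => 4 `^ s * ((wgt s (k - j))^-1 + (wgt s j)^-1)) n)).
    apply: le_psumZ => j; have w1 := wgt_gt0 s j; have w2 := wgt_gt0 s (k - j).
    rewrite -invfM ler_pdivrMr ?mulr_gt0//.
    apply: le_trans (wgt_split_add j k s0) _.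
    rewrite -mulrA ler_wpM2l ?powR_ge0// le_eqVlt; apply/orP; left; apply/eqP.
    by field; rewrite !gt_eqF.
  rewrite psumZM psumZD ler_wpM2l ?powR_ge0// lerD//.
  exact: (@psumZ_inj_le _ (fun j => (wgt s j)^-1) _ (fun j => k - j)).
(* Cauchy-Schwarz after inserting the weights: one factor is controlled by [gam], the other is a
   convolution of the two squared norms. *)
have PE k n : wgt s k * P k n ^+ 2 <=
    E * psumZ (fun j => Hterm s a j * Hterm s b (k - j)) n.
  have -> : P k n = \sum_(j <- window n) ((swgt s j)^-1 * (swgt s (k - j))^-1) *
      ((swgt s j * normc (a j)) * (swgt s (k - j) * normc (b (k - j)))).
    rewrite /P psumZE; apply: eq_bigr => j _; rewrite /g normcM.
    by field; rewrite !gt_eqF ?swgt_gt0.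
  apply: le_trans (ler_wpM2l (ltW (wgt_gt0 _ _)) (sum_mul_sqr_le _ _ _)) _.
  rewrite mulrA.
  under [X in _ * X * _]eq_bigr do rewrite exprMn !exprVn !sqr_swgt.
  under [X in _ * _ * X]eq_bigr do rewrite [(_ * (_ * _)) ^+ 2]exprMn -!HtermE.
  rewrite -!psumZE ler_wpM2r ?gam//.
  by apply: psumZ_ge0 => j; rewrite mulr_ge0 ?Hterm_ge0.
(* Both index ranges are finite here, so the sums may be exchanged: for fixed j, the sum over k of
   the shifted terms is at most B^2. *)
have fin n : \sum_(k <- window N) wgt s k * P k n ^+ 2 <= E * (A ^+ 2 * B ^+ 2).
  apply: le_trans (ler_sum _ (fun k _ => PE k n)) _.
  rewrite -mulr_sumr ler_wpM2l//.
  under eq_bigr do rewrite psumZE.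
  rewrite exchange_big/=; apply: (@le_trans _ _ (\sum_(j <- window n) Hterm s a j * B ^+ 2)).
    apply: ler_sum => j _; rewrite -mulr_sumr ler_wpM2l ?Hterm_ge0//.
    rewrite -psumZE; apply: (@psumZ_inj_le _ (Hterm s b) _ (fun k => k - j)).
    - by move=> x y /addIr.
    - exact: Hterm_ge0.
    - exact: bB.2.
  by rewrite -mulr_suml ler_wpM2r ?sqr_ge0// -psumZE; exact: aA.2.
(* Only now does n tend to infinity, with the outer window N still fixed. *)
have lim_le : \sum_(k <- window N) wgt s k * p k ^+ 2 <= E * (A ^+ 2 * B ^+ 2).
  have c := @cvg_sum_sqr (window N) P p (wgt s) Pp.
  rewrite -(cvg_lim _ c)//; apply: limr_le; last exact: nearW.
  by apply/cvg_ex; eexists; exact: c.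
have -> : (2 * Num.sqrt E * (A * B)) ^+ 2 = 4 * (E * (A ^+ 2 * B ^+ 2)).
  by rewrite -[in RHS](sqr_sqrtr E0); ring.
apply: (@le_trans _ _ (4 * \sum_(k <- window N) wgt s k * p k ^+ 2)); last first.
  by rewrite ler_wpM2l.
rewrite psumZE mulr_sumr; apply: ler_sum => k _.
rewrite HtermE exprMn sqr_swgt [leRHS]mulrCA; apply: ler_wpM2l; first exact: ltW (wgt_gt0 _ _).
have -> : 4 * p k ^+ 2 = (2 * p k) ^+ 2 by ring.
by rewrite ler_pXn2r ?nnegrE ?normc_ge0// (le_trans (normc_ge0 _) (convp k)).
Qed.

End convolution.

(** * Powers and the nonlinear term *)

Section nonlinearity.
Context {R : realType}.
Implicit Types (s A B M D : R) (a b c d : fseq R) (U V : state R).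

Lemma conv_lip s s' K a b c d A B D D' : 0 <= s ->
  (forall a b A B, HB s a A -> HB s b B -> HB s' (conv a b) (K * (A * B))) ->
  HB s a A -> HB s b B -> HB s c A -> HB s d B ->
  HB s (subS a c) D -> HB s (subS b d) D' ->
  HB s' (subS (conv a b) (conv c d)) (K * (D * B + A * D')).
Proof.
move=> s0 hK aA bB cA dB acD bdD; rewrite (convB s0 aA bB cA dB) mulrDr.
by apply: HB_add; apply: hK.
Qed.

(** [convpow a n] is the power n+1, so n = 0 involves no product and the algebra property is
    required only for n > 0. *)
Lemma convpow_lip s n : (0 < n)%N ==> (2^-1 < s) -> 0 <= s ->
  exists2 K : R, 0 <= K & forall a b M D,
    HB s a M -> HB s b M -> HB s (subS a b) D ->
    HB s (convpow a n) (K * M ^+ n.+1) /\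
    HB s (subS (convpow a n) (convpow b n)) (K * (M ^+ n * D)).
Proof.
move=> hn s0; elim: n hn => [_|n IH hn].
  by exists 1 => // a b M D aM bM abD /=; rewrite expr1 expr0 !mul1r.
have /IH[K K0 hK] : (0 < n)%N ==> (2^-1 < s).
  by apply/implyP => n0; move/implyP: hn; apply.
have [K' K'0 hK'] := conv_HB (implyP hn isT).
(* The two terms of the product rule contribute K M^n D * M and K M^(n+1) * D. *)
exists (K' * (K + K)); first by rewrite mulr_ge0 ?addr_ge0.
move=> a b M D aM bM abD.
have [M0 D0] : 0 <= M /\ 0 <= D by split; [exact: aM.1|exact: abD.1].
have [an abn] := hK _ _ _ _ aM bM abD.
(* The bound on the power of b comes from the induction hypothesis for the pair (b, b), at distance
   0. *)
have ba : HB s (subS b b) 0.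
  split=> // N; rewrite expr0n/= psumZE big1// => k _.
  by rewrite HtermE /subS subrr (normc_zero (R := R)) mulr0 expr0n.
have [bn _] := hK _ _ _ _ bM bM ba.
split=> /=.
  apply: (@le_HB _ s _ (K' * ((K * M ^+ n.+1) * M))); first exact: hK'.
  rewrite -[leRHS]mulrA ler_wpM2l// -mulrA -exprSr mulrDl lerDl mulr_ge0 ?exprn_ge0//.
apply: (@le_HB _ s _ (K' * ((K * (M ^+ n * D)) * M + K * M ^+ n.+1 * D))).
  exact: conv_lip an aM bn bM abn abD.
rewrite -[leRHS]mulrA ler_wpM2l// le_eqVlt; apply/orP; left; apply/eqP.
by rewrite exprS; ring.
Qed.

Lemma realseq_convpow s n a M : (0 < n)%N ==> (2^-1 < s) -> 0 <= s ->
  HB s a M -> realseq a -> realseq (convpow a n).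
Proof.
move=> hn s0 aM ra; elim: n hn => [_|n IH hn]; first exact: ra.
have hn' : (0 < n)%N ==> (2^-1 < s).
  by apply/implyP => n0; move/implyP: hn; apply.
have [K K0 hK] := convpow_lip hn' s0.
have aa := HB_sub aM aM.
exact: realseq_conv s0 (hK _ _ _ _ aM aM aa).1 aM (IH hn') ra.
Qed.

Definition mult_G (p : nat) (k : int) : R[i] :=
  Jinv k * Dx k * ((p.+1%:R)^-1)%:C%C.

Lemma normc_Jinv k : normc (Jinv k : R[i]) = (1 + k%:~R ^+ 2)^-1.
Proof. by rewrite normc_real ger0_norm// invr_ge0 bracket_ge0. Qed.

Lemma normc_Dx k : normc (Dx k : R[i]) = `|k%:~R|.
Proof. by rewrite DxE /= expr0n/= add0r sqrtr_sqr. Qed.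

Lemma abs_le_jap (k : int) : `|k%:~R : R| <= jap k.
Proof. by rewrite -sqrtr_sqr /jap ler_sqrt ?bracket_ge0// lerDr. Qed.

Lemma normc_mult_G p k : normc (mult_G p k) * jap k <= 1.
Proof.
rewrite /mult_G 2!normcM normc_Jinv normc_Dx normc_real -sqr_jap.
have j0 := jap_gt0 k (R := R).
have p0 : `|(p.+1%:R)^-1 : R| <= 1.
  by rewrite ger0_norm ?invr_ge0// invf_le1// ler1n.
have -> : (jap k ^+ 2)^-1 * `|k%:~R| * `|(p.+1%:R)^-1 : R| * jap k =
   ((jap k)^-1 * `|k%:~R|) * `|(p.+1%:R)^-1|.
  by field; rewrite gt_eqF.
have h : (jap k)^-1 * `|k%:~R : R| <= 1 by rewrite ler_pdivrMl// mulr1 abs_le_jap.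
have := @ler_pM R _ _ _ _ _ _ h p0; rewrite mulr1; apply=> //.
by rewrite mulr_ge0// invr_ge0 ltW.
Qed.

(** The multiplier has size at most 1/<k>; this restores the derivative lost in [conv_HB_pred]. *)
Lemma HB_mult_G s p a M : HB (s - 1) a M -> HB s (fun k => mult_G p k * a k) M.
Proof.
move=> [M0 aM]; split=> // N; apply: le_trans (aM N); apply: le_psumZ => k.
rewrite !HtermE ler_pXn2r ?nnegrE ?mulr_ge0 ?swgt_ge0 ?normc_ge0//.
rewrite swgt_pred normcM.
have -> : jap k * swgt (s - 1) k * (normc (mult_G p k) * normc (a k)) =
  (normc (mult_G p k) * jap k) * (swgt (s - 1) k * normc (a k)) by ring.
by rewrite ler_piMl ?normc_mult_G// mulr_ge0 ?swgt_ge0 ?normc_ge0.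
Qed.

Lemma realseq_mult_G p a : realseq a -> realseq (fun k => mult_G p k * a k).
Proof.
move=> ra k; rewrite ra rmorphM/=; congr (_ * _).
rewrite /mult_G !DxE /Jinv mulrNz sqrrN.
by apply: complexP; rewrite /=; ring.
Qed.

Section Gnl.
Variables (s : R) (p : nat).
Hypotheses (p1 : (1 <= p)%N) (hs1 : p = 1%N -> 0 <= s) (hsp : (1 < p)%N -> 2^-1 < s).

Lemma regularity_ge0 : 0 <= s.
Proof.
have [e|p2] := eqVneq p 1%N; first exact: hs1 e.
by apply: le_trans (ltW (hsp _)); rewrite ?invr_ge0// ltn_neqAle eq_sym p2.
Qed.

Lemma regularity_pred : (0 < p.-1)%N ==> (2^-1 < s).
Proof. by apply/implyP => p0; apply: hsp; lia. Qed.

(** With u^(p+1) = u^p u, the factor u^p is estimated in H^s by the algebra property, the last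
    product lands in H^(s-1), and the multiplier returns to H^s. For p = 1 the first stage is the
    identity. *)
Lemma Gnl_lip : exists2 K : R, 0 <= K & forall U V M D,
  XB s U M -> XB s V M -> XB s (subX U V) D ->
  XB s (Gnl p U) (K * M ^+ p.+1) /\
  XB s (subX (Gnl p U) (Gnl p V)) (K * (M ^+ p * D)).
Proof.
have s0 := regularity_ge0.
have [K K0 hK] := convpow_lip regularity_pred s0.
have [K' K'0 hK'] := conv_HB_pred s0.
exists (K' * (K + K)); first by rewrite mulr_ge0 ?addr_ge0.
move=> U V M D UM VM UVD.
have aM := XB_HB UM; have bM := XB_HB VM; have abD := XB_HB UVD.
have M0 := aM.1; have D0 := abD.1.
have [an abn] := hK _ _ _ _ aM bM abD.
have [bn _] := hK _ _ _ _ bM aM (XB_HB (XB_subC UVD)).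
rewrite prednK// in an bn.
have pE c : convpow c p = conv (convpow c p.-1) c by rewrite -{1}(prednK p1).
split.
  apply/XB_fst_state/HB_mult_G; rewrite pE.
  apply: (@le_HB _ _ _ (K' * ((K * M ^+ p) * M))); first exact: hK'.
  by rewrite -[leRHS]mulrA ler_wpM2l// -mulrA -exprSr mulrDl lerDl mulr_ge0 ?exprn_ge0.
have -> : subX (Gnl p U) (Gnl p V) =
    fst_state (fun k => mult_G p k * (subS (convpow U.1 p) (convpow V.1 p)) k).
  rewrite /subX /fst_state /subS/=; congr (_, _); apply/funext => k.
    by rewrite mulrBr.
  by rewrite subrr.
apply/XB_fst_state/HB_mult_G; rewrite !pE.
apply: (@le_HB _ _ _ (K' * ((K * (M ^+ p.-1 * D)) * M + K * M ^+ p * D))).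
  exact: conv_lip an aM bn bM abn abD.
rewrite -[leRHS]mulrA ler_wpM2l// le_eqVlt; apply/orP; left; apply/eqP.
by rewrite -(prednK p1) exprS/=; ring.
Qed.

Lemma real_state_Gnl U M : XB s U M -> real_state U -> real_state (Gnl p U).
Proof.
move=> /XB_HB aM [ra _]; split; last by move=> k; exact: (esym (conjc0 _)).
apply: realseq_mult_G; have -> : convpow U.1 p = conv (convpow U.1 p.-1) U.1.
  by rewrite -{1}(prednK p1).
have s0 := regularity_ge0.
have [K K0 hK] := convpow_lip regularity_pred s0.
have an := (hK _ _ _ _ aM aM (HB_sub aM aM)).1.
exact: realseq_conv s0 an aM (realseq_convpow regularity_pred s0 aM ra) ra.
Qed.

End Gnl.
End nonlinearity.

(** * The group generated by A *)

Section group.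
Context {R : realType}.
Implicit Types (s t x y p q M : R) (U V : state R).

Lemma abs_sin_le x : `|sin x| <= `|x|.
Proof.
have pos y : 0 <= y -> `|sin y| <= y.
  rewrite le_eqVlt => /predU1P[<-|y0]; first by rewrite sin0 normr0.
  have [|c _] := @MVT R sin cos 0 y y0.
    by apply: continuous_subspaceT => z; exact: continuous_sin.
  rewrite sin0 !subr0 => ->; rewrite normrM (gtr0_norm y0) ler_piMl ?(ltW y0)//.
  by rewrite ler_norml cos_geN1 cos_le1.
have [x0|x0] := leP 0 x; first by rewrite (ger0_norm x0) pos.
by rewrite -normrN -sinN (ltr0_norm x0) pos// oppr_ge0 ltW.
Qed.

(** A chord is no longer than its arc: the left side is 4 sin^2 of half the angle difference. *)
Lemma trig_dist_le x y : (cos x - cos y) ^+ 2 + (sin x - sin y) ^+ 2 <= (x - y) ^+ 2.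
Proof.
have -> : (cos x - cos y) ^+ 2 + (sin x - sin y) ^+ 2 = 2 - 2 * cos (x - y).
  rewrite cosB; have := cos2Dsin2 x; have := cos2Dsin2 y; nra.
pose z := (x - y) / 2; have -> : x - y = z *+ 2 by rewrite /z -mulr_natr; field.
rewrite cos_mulr2n; have := sin2cos2 z.
have : sin z ^+ 2 <= z ^+ 2.
  by rewrite -(real_normK (num_real (sin z))) -(real_normK (num_real z)) ler_sqr
    ?nnegrE ?abs_sin_le.
by rewrite !mulr2n; nra.
Qed.

Lemma lim_trig x p q :
  lim (series (fun n => cos_coeff x n * p + sin_coeff x n * q) @ \oo) =
  cos x * p + sin x * q.
Proof.
have -> : series (fun n => cos_coeff x n * p + sin_coeff x n * q) =
    (fun n => series (cos_coeff x) n * p + series (sin_coeff x) n * q).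
  by apply/funext => n; rewrite /series/= big_split/= -!mulr_suml.
apply: cvg_lim => //; apply: cvgD; apply: cvgMl.
  have -> : cos x = lim (series (cos_coeff x) @ \oo) by rewrite unlock.
  exact: is_cvg_series_cos_coeff.
have -> : sin x = lim (series (sin_coeff x) @ \oo) by rewrite unlock.
  exact: is_cvg_series_sin_coeff.
Qed.

(** The frequency of mode k: A has eigenvalues plus and minus i [om k] on it. *)
Definition om (k : int) : R := k%:~R / jap k.

(** In the balanced coordinates (u_k, v_k/<k>) this is al + i be S, with S the swap. The pair (al,
    be) is left free so that differences of two propagators have the same form. *)
Definition rot (al be : int -> R) U : state R :=
  (fun k => Complex (al k * complex.Re (U.1 k) - be k / jap k * complex.Im (U.2 k))
                    (al k * complex.Im (U.1 k) + be k / jap k * complex.Re (U.2 k)),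
   fun k => Complex (al k * complex.Re (U.2 k) - be k * jap k * complex.Im (U.1 k))
                    (al k * complex.Im (U.2 k) + be k * jap k * complex.Re (U.1 k))).

(** With w = v/<k>, the cross terms are multiples of Im(u conj w) and Im(w conj u), which cancel. *)
Lemma Xterm_rot s al be U k :
  Xterm s (rot al be U) k = (al k ^+ 2 + be k ^+ 2) * Xterm s U k.
Proof.
rewrite /Xterm /Hterm /cabs2/= (wgt_pred s) -sqr_jap; field.
by rewrite gt_eqF// jap_gt0.
Qed.

Lemma XB_rot s al be U M c : 0 <= c -> (forall k, al k ^+ 2 + be k ^+ 2 <= c ^+ 2) ->
  XB s U M -> XB s (rot al be U) (c * M).
Proof.
move=> c0 hc [M0 UM]; split=> [|N]; first exact: mulr_ge0.
rewrite exprMn; apply: (@le_trans _ _ (c ^+ 2 * psumZ (Xterm s U) N)).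
  by rewrite -psumZM; apply: le_psumZ => k; rewrite Xterm_rot ler_wpM2r ?Xterm_ge0.
by rewrite ler_wpM2l ?sqr_ge0.
Qed.

(** With [so] below, i^n = [ce n] + i [so n]: the numerators of the cosine and sine series. *)
Let ce (n : nat) : R := (~~ odd n)%:R * (-1) ^+ n./2.
Let so (n : nat) : R := (odd n)%:R * (-1) ^+ n.-1./2.

Let ceS n : ce n.+1 = - so n.
Proof.
rewrite /ce /so /=; case: n => [|n]; first by rewrite !mul0r oppr0.
by rewrite /= negbK exprS mulN1r mulrN.
Qed.

Let soS n : so n.+1 = ce n.
Proof. by rewrite /ce /so. Qed.

(** In balanced coordinates A is i [om k] S with S^2 = 1, so S survives only in odd powers. *)
Lemma iter_Amode (a b : R[i]) k n :
  iter n (Amode k) (a, b) =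
  (Complex (om k ^+ n * (ce n * complex.Re a - so n / jap k * complex.Im b))
           (om k ^+ n * (ce n * complex.Im a + so n / jap k * complex.Re b)),
   Complex (om k ^+ n * (ce n * complex.Re b - so n * jap k * complex.Im a))
           (om k ^+ n * (ce n * complex.Im b + so n * jap k * complex.Re a))).
Proof.
have j0 : jap k != 0 :> R by rewrite gt_eqF// jap_gt0.
elim: n => [|n IH].
  rewrite /= /ce /so /= expr0 !mul1r !mul0r.
  by rewrite !subr0 !addr0; case: a b => [? ?] [? ?].
rewrite iterS IH ceS soS /Amode DxE /Jinv -sqr_jap /= [om k ^+ n.+1]exprS.
move: (om k ^+ n) => w; move: (ce n) (so n) => c d.
congr (_, _); apply: complexP; rewrite /= /om; by field.
Qed.

Lemma csumN_trig x (z w : R[i]) :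
  csumN (fun n => (cos_coeff x n)%:C%C * z + (sin_coeff x n)%:C%C * w) =
  (cos x)%:C%C * z + (sin x)%:C%C * w.
Proof.
rewrite /csumN; apply: complexP; rewrite (cReD, cImD) (cReM, cImM) (cReM, cImM)/=;
  rewrite !mul0r !(subr0, addr0) -lim_trig; congr (lim (series _ @ \oo));
  by apply/funext => n; rewrite (cReD, cImD) (cReM, cImM) (cReM, cImM)/= !mul0r !(subr0, addr0).
Qed.

Let cos_coeff_om x t n : cos_coeff (x * t) n = ce n * (x ^+ n * t ^+ n) / n`!%:R.
Proof. by rewrite /cos_coeff/= exprMn. Qed.

Let sin_coeff_om x t n : sin_coeff (x * t) n = so n * (x ^+ n * t ^+ n) / n`!%:R.
Proof. by rewrite /sin_coeff/= exprMn. Qed.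

(** Summed against t^n/n!, the factors [ce] and [so] produce the cosine and sine series at
    [om k * t]. *)
Lemma expAE t U :
  expA t U = rot (fun k => cos (om k * t)) (fun k => sin (om k * t)) U.
Proof.
rewrite /expA /rot; congr (_, _); apply/funext => k.
  transitivity (csumN (fun n => (cos_coeff (om k * t) n)%:C%C * U.1 k +
      (sin_coeff (om k * t) n)%:C%C * Complex (- complex.Im (U.2 k) / jap k)
                                             (complex.Re (U.2 k) / jap k))).
    congr csumN; apply/funext => n; rewrite iter_Amode.
    apply: complexP; rewrite (cReD, cImD) !(cReM, cImM)/= cos_coeff_om sin_coeff_om /ce /so; ring.
  rewrite csumN_trig; apply: complexP; rewrite (cReD, cImD) !(cReM, cImM)/=; ring.
transitivity (csumN (fun n => (cos_coeff (om k * t) n)%:C%C * U.2 k +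
    (sin_coeff (om k * t) n)%:C%C * Complex (- complex.Im (U.1 k) * jap k)
                                           (complex.Re (U.1 k) * jap k))).
  congr csumN; apply/funext => n; rewrite iter_Amode.
  apply: complexP; rewrite (cReD, cImD) !(cReM, cImM)/= cos_coeff_om sin_coeff_om /ce /so; ring.
rewrite csumN_trig; apply: complexP; rewrite (cReD, cImD) !(cReM, cImM)/=; ring.
Qed.

Lemma om_opp k : om (- k) = - om k.
Proof. by rewrite /om /jap mulrNz sqrrN mulNr. Qed.

Lemma sqr_om_le1 k : om k ^+ 2 <= 1.
Proof.
rewrite /om expr_div_n sqr_jap ler_pdivrMr ?bracket_gt0// mul1r.
by rewrite lerDr.
Qed.

Lemma XB_expA s t U M : XB s U M -> XB s (expA t U) M.
Proof.
move=> UM; rewrite expAE -[M]mul1r; apply: XB_rot => // k.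
by rewrite cos2Dsin2 expr1n.
Qed.

Lemma rotB al be al' be' U : subX (rot al be U) (rot al' be' U) =
  rot (fun k => al k - al' k) (fun k => be k - be' k) U.
Proof.
rewrite /subX /rot /subS/=; congr (_, _); apply/funext => k; apply: complexP;
  rewrite ?cReB ?cImB/=; ring.
Qed.

(** Since |om k| <= 1, the chord bound is uniform in k; equivalently, A is bounded on X^s. *)
Lemma XB_expA_time s t t' U M : XB s U M ->
  XB s (subX (expA t U) (expA t' U)) (`|t - t'| * M).
Proof.
move=> UM; rewrite !expAE rotB; apply: XB_rot => // k.
apply: le_trans (trig_dist_le _ _) _; rewrite -mulrBr exprMn.
by rewrite real_normK ?num_real// ler_piMl ?sqr_ge0// sqr_om_le1.
Qed.

Lemma expA_sub t U V : subX (expA t U) (expA t V) = expA t (subX U V).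
Proof.
rewrite !expAE /subX /rot /subS/=; congr (_, _); apply/funext => k; apply: complexP;
  rewrite ?cReB ?cImB/=; ring.
Qed.

Lemma real_state_expA t U : real_state U -> real_state (expA t U).
Proof.
move=> [r1 r2]; rewrite expAE; split=> k; rewrite /= om_opp mulNr cosN sinN r1 r2 /jap
  mulrNz sqrrN -/(jap k); apply: complexP => /=; move: (U.1 k) (U.2 k) => [a b] [c d]/=; ring.
Qed.

End group.

(** * Duhamel integrals *)

Section integral_l2.
Context d (X : measurableType d) (R : realType) (mu : {measure set X -> \bar R}).
Implicit Types (D : set X) (h : X -> R).

Lemma integrable_add D (f g : X -> R) : measurable D ->
  mu.-integrable D (EFin \o f) -> mu.-integrable D (EFin \o g) ->
  mu.-integrable D (EFin \o (fun x => f x + g x)).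
Proof. move=> mD jf jg; exact: (eq_integrable mD _ _ _ (integrableD mD jf jg)). Qed.

Lemma integrable_sub D (f g : X -> R) : measurable D ->
  mu.-integrable D (EFin \o f) -> mu.-integrable D (EFin \o g) ->
  mu.-integrable D (EFin \o (fun x => f x - g x)).
Proof. move=> mD jf jg; exact: (eq_integrable mD _ _ _ (integrableB mD jf jg)). Qed.

Lemma integrable_scale D (c : R) (f : X -> R) : measurable D ->
  mu.-integrable D (EFin \o f) -> mu.-integrable D (EFin \o (fun x => c * f x)).
Proof. move=> mD jf; exact: (eq_integrable mD _ _ _ (integrableZl mD c jf)). Qed.

Lemma integrable_lin (J : Type) (r : seq J) (c : J -> R) (G : J -> X -> R) D :
  measurable D -> (forall j, mu.-integrable D (EFin \o G j)) ->
  mu.-integrable D (EFin \o (fun x => \sum_(j <- r) c j * G j x)) /\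
  \int[mu]_(x in D) (\sum_(j <- r) c j * G j x) =
  \sum_(j <- r) c j * \int[mu]_(x in D) G j x.
Proof.
move=> mD iG; elim: r => [|j r [IH1 IH2]].
  split; last by rewrite big_nil; under eq_Rintegral do rewrite big_nil;
    rewrite Rintegral_cst// mul0r.
  apply: (@eq_integrable _ _ _ mu D mD (cst 0%E)); last exact: integrable0.
  by move=> x _ /=; rewrite big_nil.
have i1 := integrable_scale (c j) mD (iG j).
split.
  apply: (eq_integrable mD _ _ _ (integrable_add mD i1 IH1)).
  by move=> x _ /=; rewrite big_cons.
under eq_Rintegral do rewrite big_cons.
by rewrite RintegralD// IH2 RintegralZl// big_cons.
Qed.

(* Minkowski's integral inequality, by testing against the integral itself. *)
Lemma l2_Rintegral (J : Type) (r : seq J) (G : J -> X -> R) h D : measurable D ->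
  (forall j, mu.-integrable D (EFin \o G j)) -> mu.-integrable D (EFin \o h) ->
  (forall x, D x -> 0 <= h x /\ \sum_(j <- r) G j x ^+ 2 <= h x ^+ 2) ->
  \sum_(j <- r) (\int[mu]_(x in D) G j x) ^+ 2 <= (\int[mu]_(x in D) h x) ^+ 2.
Proof.
move=> mD iG ih Gh; pose I j := \int[mu]_(x in D) G j x.
pose q := Num.sqrt (\sum_(j <- r) I j ^+ 2).
have S0 : 0 <= \sum_(j <- r) I j ^+ 2 by apply: sumr_ge0 => j _; exact: sqr_ge0.
have q2 : q ^+ 2 = \sum_(j <- r) I j ^+ 2 by rewrite sqr_sqrtr.
have h0 : 0 <= \int[mu]_(x in D) h x by apply: Rintegral_ge0 => x /Gh[].
have [i1 i2] := integrable_lin r I mD iG.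
have ih' := integrable_scale q mD ih.
(* q^2 is the integral of the pairing of I with G(x), which pointwise Cauchy-Schwarz bounds by q
   h(x). *)
have le : q ^+ 2 <= q * \int[mu]_(x in D) h x.
  have -> : q ^+ 2 = \int[mu]_(x in D) (\sum_(j <- r) I j * G j x).
    by rewrite i2 q2; apply: eq_bigr => j _; rewrite expr2.
  rewrite -RintegralZl//; apply: le_Rintegral => // x /Gh[hx Ghx].
  by apply: sum_mul_le => //; [exact: sqrtr_ge0|rewrite q2].
rewrite -q2; have [q0|q0] := eqVneq q 0; first by rewrite q0 expr0n/= sqr_ge0.
have qp : 0 < q by rewrite lt_neqAle eq_sym q0 sqrtr_ge0.
by move: le; rewrite ler_sqr ?nnegrE ?(ltW qp)// expr2 ler_pM2l.
Qed.

Lemma integrable_dom D (g h : X -> R) : measurable D -> measurable_fun D g ->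
  mu.-integrable D (EFin \o h) -> (forall x, D x -> `|g x| <= h x) ->
  mu.-integrable D (EFin \o g).
Proof.
move=> mD mg ih gh; apply: (le_integrable mD _ _ ih).
  exact/measurable_EFinP.
move=> x Dx /=; rewrite lee_fin; apply: le_trans (gh x Dx) _; exact: ler_norm.
Qed.

End integral_l2.

Section Duhamel.
Context {R : realType}.
Notation mu := (@lebesgue_measure R).
Implicit Types (s t T M : R) (U V : state R) (H : R -> state R) (h : R -> R).

Lemma coord_inj s U V : (forall j, coord s U j = coord s V j) -> U = V.
Proof.
case: U V => [u1 u2] [v1 v2] e; congr (_, _); apply/funext => k; apply: complexP.
- by apply: (mulfI (lt0r_neq0 (swgt_gt0 s k))); exact: (e (k, 0%N)).
- by apply: (mulfI (lt0r_neq0 (swgt_gt0 s k))); exact: (e (k, 1%N)).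
- by apply: (mulfI (lt0r_neq0 (swgt_gt0 (s - 1) k))); exact: (e (k, 2%N)).
- by apply: (mulfI (lt0r_neq0 (swgt_gt0 (s - 1) k))); exact: (e (k, 3%N)).
Qed.

Definition parity (i : nat) : R := match i with 0%N | 2%N => 1 | _ => -1 end.

(** Turns realness into linear relations between coordinates, which integrals and limits preserve;
    [parity] is the sign of conjugation on each part. *)
Lemma real_state_coord s U :
  real_state U <-> forall k i, coord s U (- k, i) = parity i * coord s U (k, i).
Proof.
have sw s' k : swgt s' (- k) = swgt s' k :> R by rewrite /swgt wgt_opp.
split=> [[r1 r2] k i|e].
  rewrite /coord; case: i => [|[|[|i]]] /=; rewrite sw (r1, r2) ?mul1r// ?mulN1r -?mulrN;
  by congr (_ * _); case: (_ k).
split=> k; apply: complexP.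
- apply: (mulfI (lt0r_neq0 (swgt_gt0 s k))); move: (e k 0%N); rewrite /coord/= sw mul1r => ->.
  by case: (U.1 k).
- apply: (mulfI (lt0r_neq0 (swgt_gt0 s k))); move: (e k 1%N); rewrite /coord/= sw => ->.
  by case: (U.1 k) => a b /=; ring.
- apply: (mulfI (lt0r_neq0 (swgt_gt0 (s - 1) k))); move: (e k 2%N); rewrite /coord/= sw mul1r => ->.
  by case: (U.2 k).
- apply: (mulfI (lt0r_neq0 (swgt_gt0 (s - 1) k))); move: (e k 3%N); rewrite /coord/= sw => ->.
  by case: (U.2 k) => a b /=; ring.
Qed.

Lemma XB_coord s U M : XB s U M <->
  0 <= M /\ forall N, \sum_(j <- coords N) coord s U j ^+ 2 <= M ^+ 2.
Proof. by split=> -[M0 UM]; split=> // N; rewrite (=^~ psumZ_coord, psumZ_coord). Qed.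

Definition duh H t : state R :=
  (fun k => cint (fun tau => (expA (t - tau) (H tau)).1 k) t,
   fun k => cint (fun tau => (expA (t - tau) (H tau)).2 k) t).

Definition msrc s T H := forall j, measurable_fun `[0, T] (fun tau => coord s (H tau) j).

(** A stand-in for Bochner integrability: measurable coordinates and an integrable majorant of the
    norm. The majorant is free: a constant for the nonlinearity, the norm itself for the forcing. *)
Definition source s T H h := [/\ msrc s T H, mu.-integrable `[0, T] (EFin \o h) &
  forall tau, 0 <= tau <= T -> XB s (H tau) (h tau)].

Lemma coord_rot s al be U (k : int) i : coord s (rot al be U) (k, i) =
  match i with
  | 0%N => al k * coord s U (k, 0%N) - be k * coord s U (k, 3%N)
  | 1%N => al k * coord s U (k, 1%N) + be k * coord s U (k, 2%N)
  | 2%N => al k * coord s U (k, 2%N) - be k * coord s U (k, 1%N)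
  | _ => al k * coord s U (k, 3%N) + be k * coord s U (k, 0%N)
  end.
Proof.
rewrite /coord/= (swgt_pred s); have j0 : jap k != 0 :> R by rewrite gt_eqF// jap_gt0.
by case: i => [|[|[|i]]]; field.
Qed.

Lemma measurable_coord_expA s T H t j : msrc s T H ->
  measurable_fun `[0, T] (fun tau => coord s (expA (t - tau) (H tau)) j).
Proof.
move=> mH; case: j => k i.
have mc : measurable_fun `[0, T] (fun tau => cos (om k * (t - tau))).
  apply: (@measurable_funTS _ _ _ _ `[0, T]); apply: measurableT_comp.
    by apply: continuous_measurable_fun; exact: continuous_cos.
  by apply: measurable_funM => //; apply: measurable_funB.
have ms : measurable_fun `[0, T] (fun tau => sin (om k * (t - tau))).
  apply: (@measurable_funTS _ _ _ _ `[0, T]); apply: measurableT_comp.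
    by apply: continuous_measurable_fun; exact: continuous_sin.
  by apply: measurable_funM => //; apply: measurable_funB.
pose c tau i' := coord s (H tau) (k, i').
have -> : (fun tau => coord s (expA (t - tau) (H tau)) (k, i)) = (fun tau =>
    match i with
    | 0%N => cos (om k * (t - tau)) * c tau 0%N - sin (om k * (t - tau)) * c tau 3%N
    | 1%N => cos (om k * (t - tau)) * c tau 1%N + sin (om k * (t - tau)) * c tau 2%N
    | 2%N => cos (om k * (t - tau)) * c tau 2%N - sin (om k * (t - tau)) * c tau 1%N
    | _ => cos (om k * (t - tau)) * c tau 3%N + sin (om k * (t - tau)) * c tau 0%N
    end).
  by apply/funext => tau; rewrite expAE coord_rot.
by case: i => [|[|[|i]]];
  (apply: measurable_funB || apply: measurable_funD); apply: measurable_funM => //; exact: mH.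
Qed.

Lemma itv_sub (a b c d : R) : c <= a -> b <= d -> `[a, b] `<=` `[c, d].
Proof. by move=> ca bd x /=; rewrite !in_itv/= => /andP[? ?]; apply/andP; split; lra. Qed.

Lemma integrable_coord_expA s T H h t j : source s T H h ->
  mu.-integrable `[0, T] (EFin \o (fun tau => coord s (expA (t - tau) (H tau)) j)).
Proof.
move=> [mH ih Hh]; apply: integrable_dom ih _ => //; first exact: measurable_coord_expA.
move=> x /=; rewrite in_itv/= => /Hh xh; apply: coord_le; exact: XB_expA.
Qed.

Lemma coord_duh s T H h t j : source s T H h -> 0 <= t <= T ->
  coord s (duh H t) j = \int[mu]_(tau in `[0, t]) coord s (expA (t - tau) (H tau)) j.
Proof.
move=> sH /andP[t0 tT].
have ij j' : mu.-integrable `[0, t] (EFin \o (fun tau => coord s (expA (t - tau) (H tau)) j')).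
  by apply: integrableS (integrable_coord_expA t j' sH) => //; exact: itv_sub.
(* Integrability is known for w g, so w^-1 is moved into the integral of w g. *)
have pull (w : R) (g : R -> R) : w != 0 ->
    mu.-integrable `[0, t] (EFin \o (fun x => w * g x)) ->
    w * \int[mu]_(x in `[0, t]) g x = \int[mu]_(x in `[0, t]) (w * g x).
  move=> w0 iw.
  rewrite -[RHS](mulVKf w0) -[w^-1 * _]RintegralZl//; congr (_ * _).
  by apply: eq_Rintegral => x _; rewrite mulKf.
case: j => k i; rewrite /coord/=.
have w1 : swgt s k != 0 := lt0r_neq0 (swgt_gt0 s k).
have w2 : swgt (s - 1) k != 0 := lt0r_neq0 (swgt_gt0 (s - 1) k).
case: i => [|[|[|i]]]; apply: pull => //.
- exact: (ij (k, 0%N)).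
- exact: (ij (k, 1%N)).
- exact: (ij (k, 2%N)).
- exact: (ij (k, 3%N)).
Qed.

(** Minkowski's inequality on every window, the propagator being an isometry. *)
Lemma XB_duh s T H h t : source s T H h -> 0 <= t <= T ->
  XB s (duh H t) (\int[mu]_(tau in `[0, t]) h tau).
Proof.
move=> sH tT; have [mH ih Hh] := sH; have /andP[t0 tT'] := tT.
have sub : `[0, t] `<=` `[0, T] by exact: itv_sub.
have Hx x : `[0, t]%classic x -> XB s (expA (t - x) (H x)) (h x).
  by move=> /sub/=; rewrite in_itv/= => /Hh; exact: XB_expA.
apply/XB_coord; split=> [|N]; first by apply: Rintegral_ge0 => x /Hx[].
under eq_bigr do rewrite (coord_duh _ sH tT).
apply: l2_Rintegral => //.
- by move=> j; apply: integrableS (integrable_coord_expA t j sH).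
- exact: integrableS ih.
- by move=> x /Hx/XB_coord[].
Qed.

Lemma real_state_duh s T H h t : source s T H h -> 0 <= t <= T ->
  (forall tau, 0 <= tau <= T -> real_state (H tau)) -> real_state (duh H t).
Proof.
move=> sH tT rH; have /andP[t0 tT'] := tT; apply/(real_state_coord s) => k i.
have sub : `[0, t] `<=` `[0, T] by exact: itv_sub.
rewrite !(coord_duh _ sH tT) -RintegralZl//; last first.
  by apply: integrableS (integrable_coord_expA t (k, i) sH).
apply: eq_Rintegral => x; rewrite inE => /sub/=; rewrite in_itv/= => /rH rx.
by have /(real_state_coord s)-> := real_state_expA (t - x) rx.
Qed.

Lemma coord_subX_duh s T H h H' h' t j : source s T H h -> source s T H' h' ->
  0 <= t <= T -> coord s (subX (duh H t) (duh H' t)) j =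
  \int[mu]_(tau in `[0, t]) coord s (expA (t - tau) (subX (H tau) (H' tau))) j.
Proof.
move=> sH sH' tT; have /andP[t0 tT'] := tT.
have sub : `[0, t] `<=` `[0, T] by exact: itv_sub.
have -> : coord s (subX (duh H t) (duh H' t)) j =
    \int[mu]_(tau in `[0, t]) coord s (expA (t - tau) (H tau)) j -
    \int[mu]_(tau in `[0, t]) coord s (expA (t - tau) (H' tau)) j.
  by rewrite coordB; congr (_ - _); [exact: (coord_duh j sH tT)|exact: (coord_duh j sH' tT)].
rewrite -RintegralB//.
- by apply: eq_Rintegral => x _; rewrite -expA_sub coordB.
- by apply: integrableS (integrable_coord_expA t j sH).
- by apply: integrableS (integrable_coord_expA t j sH').
Qed.

Lemma source_sub s T H h H' h' : source s T H h -> source s T H' h' ->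
  source s T (fun x => subX (H x) (H' x)) (fun x => h x + h' x).
Proof.
move=> [mH ih Hh] [mH' ih' Hh']; split.
- move=> j; have -> : (fun x => coord s (subX (H x) (H' x)) j) =
      (fun x => coord s (H x) j - coord s (H' x) j).
    by apply/funext => x; rewrite coordB.
  exact: measurable_funB.
- exact: integrable_add.
- by move=> x xT; apply: XB_sub; [exact: Hh|exact: Hh'].
Qed.

Lemma duh_sub s T H h H' h' t : source s T H h -> source s T H' h' -> 0 <= t <= T ->
  subX (duh H t) (duh H' t) = duh (fun x => subX (H x) (H' x)) t.
Proof.
move=> sH sH' tT; apply: (@coord_inj s) => j.
by rewrite (coord_subX_duh _ sH sH' tT) (coord_duh _ (source_sub sH sH') tT).
Qed.

(** The first term is the contribution of the new times ]t, t'], the second the change of the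
    propagator over the old times. Written as a difference, the first is small by continuity of the
    integral. *)
Lemma XB_duh_time s T H h t t' : source s T H h -> 0 <= t -> t <= t' -> t' <= T ->
  XB s (subX (duh H t') (duh H t))
    ((\int[mu]_(x in `[0, t']) h x - \int[mu]_(x in `[0, t]) h x) +
     (t' - t) * \int[mu]_(x in `[0, t]) h x).
Proof.
move=> sH t0 tt' t'T; have [mH ih Hh] := sH.
have tT : 0 <= t <= T by rewrite t0 (le_trans tt').
have tT' : 0 <= t' <= T by rewrite (le_trans t0).
have sub : `[0, t] `<=` `[0, T] by apply: itv_sub => //; exact: le_trans t'T.
have sub' : `[0, t'] `<=` `[0, T] by exact: itv_sub.
have sub2 : `]t, t'] `<=` `[0, T].
  by move=> x /=; rewrite !in_itv/= => /andP[? ?]; apply/andP; split; lra.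
have ih0 : mu.-integrable `[0, t] (EFin \o h) by exact: integrableS ih.
have ih' : mu.-integrable `[0, t'] (EFin \o h) by exact: integrableS ih.
have ih2 : mu.-integrable `]t, t'] (EFin \o h) by exact: integrableS ih.
have split_int g : mu.-integrable `[0, t'] (EFin \o g) ->
    \int[mu]_(x in `[0, t']) g x =
    \int[mu]_(x in `[0, t]) g x + \int[mu]_(x in `]t, t']) g x.
  by move=> ig; rewrite -(Rintegral_itvB ig) ?bnd_simp// addrC subrK.
rewrite (split_int _ ih') [X in X + _]addrAC subrr add0r.
have iG u j D : measurable D -> D `<=` `[0, T] ->
    mu.-integrable D (EFin \o (fun x => coord s (expA (u - x) (H x)) j)).
  by move=> mD DT; apply: integrableS (integrable_coord_expA u j sH).
have Hx u x : `[0, T]%classic x -> XB s (expA (u - x) (H x)) (h x).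
  by move=> /=; rewrite in_itv/= => /Hh; exact: XB_expA.
have a0 : 0 <= \int[mu]_(x in `]t, t']) h x.
  by apply: Rintegral_ge0 => x /sub2/(Hx 0)[].
have b0 : 0 <= \int[mu]_(x in `[0, t]) h x.
  by apply: Rintegral_ge0 => x /sub/(Hx 0)[].
have d0 : 0 <= t' - t by rewrite subr_ge0.
apply/XB_coord; split=> [|N]; first by rewrite addr_ge0// mulr_ge0.
(* The change of the propagator at source time x, of norm at most (t' - t) h(x). *)
pose G j x := coord s (expA (t' - x) (H x)) j - coord s (expA (t - x) (H x)) j.
have iGd j : mu.-integrable `[0, t] (EFin \o G j).
  by apply: integrable_sub => //; exact: iG.
have e j : coord s (subX (duh H t') (duh H t)) j =
    \int[mu]_(x in `]t, t']) coord s (expA (t' - x) (H x)) j +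
    \int[mu]_(x in `[0, t]) G j x.
  rewrite RintegralB//; [|exact: iG|exact: iG].
  rewrite addrA -[X in X - _]addrC -split_int; last exact: iG.
  by rewrite coordB; congr (_ - _); [exact: (coord_duh j sH tT')|exact: (coord_duh j sH tT)].
under eq_bigr do rewrite e.
apply: sum_sqrD_le; [by []|by rewrite mulr_ge0| |].
  apply: l2_Rintegral => //; first by move=> j; exact: iG.
  by move=> x /sub2/(Hx t')/XB_coord[].
rewrite -RintegralZl//; apply: l2_Rintegral => //.
  exact: integrable_scale.
move=> x /sub; rewrite /= in_itv/= => /Hh/(XB_expA_time (t' - x) (t - x)).
rewrite opprB addrA subrK ger0_norm// => /XB_coord[? hN]; split=> //.
apply: le_trans (hN N); rewrite le_eqVlt; apply/orP; left; apply/eqP.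
by apply: eq_bigr => j _; rewrite coordB.
Qed.

End Duhamel.

(** * Continuity and integration on an interval *)

Section interval_analysis.
Context {R : realType}.
Notation mu := (@lebesgue_measure R).
Implicit Types (T t : R) (f h : R -> R).

Lemma within_continuousP T f : {within `[0, T], continuous f} <->
  (forall t, 0 <= t <= T -> forall e, 0 < e -> exists2 d, 0 < d &
     forall t', 0 <= t' <= T -> `|t' - t| < d -> `|f t' - f t| < e).
Proof.
split=> [/subspace_continuousP cf t tT e e0|cf].
  have := cf t; rewrite /= in_itv/= => /(_ tT) /cvgrPdist_lt /(_ e e0).
  move=> [d /= d0 hd]; exists d => // t' t'T t't.
  by rewrite distrC; apply: hd; rewrite /ball_/= ?in_itv//= distrC.
apply/subspace_continuousP => t; rewrite /= in_itv/= => tT.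
apply/cvgrPdist_lt => e e0; have [d d0 hd] := cf t tT e e0.
exists d => // t' /= t't; rewrite in_itv/= => t'T.
by rewrite distrC; apply: hd => //; rewrite distrC.
Qed.

Lemma continuous_itv_measurable T f : {within `[0, T], continuous f} ->
  measurable_fun `[0, T] f.
Proof. by move=> cf; apply: subspace_continuous_measurable_fun. Qed.

Lemma continuous_itv_bounded T f : 0 <= T -> {within `[0, T], continuous f} ->
  exists M, forall t, 0 <= t <= T -> f t <= M.
Proof.
move=> T0 cf; have [c _ hc] := EVT_max T0 cf.
by exists (f c) => t tT; apply: hc; rewrite in_itv.
Qed.

Lemma integrable_cst T (c : R) : mu.-integrable `[0, T] (EFin \o (fun=> c)).
Proof.
apply: continuous_compact_integrable; first exact: segment_compact.
by apply: continuous_subspaceT => x; exact: cst_continuous.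
Qed.

Lemma Rintegral_itv_cst t (c : R) : 0 <= t -> \int[mu]_(x in `[0, t]) c = c * t.
Proof.
move=> t0; rewrite Rintegral_cst//; congr (_ * _).
suff e : lebesgue_measure (`[0, t]%classic : set R) = t%:E by exact: (congr1 fine e).
rewrite lebesgue_measure_itv/=.
move: t0; rewrite le_eqVlt => /predU1P[<-|t0] /=; first by rewrite ltxx.
by rewrite lte_fin t0 sube0.
Qed.

Lemma integrable_itvS T t h : t <= T -> mu.-integrable `[0, T] (EFin \o h) ->
  mu.-integrable `[0, t] (EFin \o h).
Proof. by move=> tT; apply: integrableS => //; exact: itv_sub. Qed.

Lemma Rintegral_itv_le T t h : 0 <= t -> t <= T -> mu.-integrable `[0, T] (EFin \o h) ->
  (forall x, 0 <= x <= T -> 0 <= h x) ->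
  \int[mu]_(x in `[0, t]) h x <= \int[mu]_(x in `[0, T]) h x.
Proof.
move=> t0 tT ih h0; rewrite -subr_ge0 Rintegral_itvB ?bnd_simp//.
apply: Rintegral_ge0 => x /=; rewrite in_itv/= => /andP[tx xT]; apply: h0.
by rewrite xT andbT (le_trans t0)// ltW.
Qed.

Lemma Rintegral_itv_continuous T h : 0 <= T -> mu.-integrable `[0, T] (EFin \o h) ->
  forall t, 0 <= t <= T -> forall e, 0 < e -> exists2 d, 0 < d &
    forall t', 0 <= t' <= T -> `|t' - t| < d ->
      `|\int[mu]_(x in `[0, t']) h x - \int[mu]_(x in `[0, t]) h x| < e.
Proof.
by move=> T0 ih; apply/within_continuousP; exact: parameterized_integral_continuous.
Qed.

Lemma Rintegral_expR (c t : R) : 0 < c -> 0 <= t ->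
  mu.-integrable `[0, t] (EFin \o (fun x => expR (c * x))) /\
  \int[mu]_(x in `[0, t]) expR (c * x) = (expR (c * t) - 1) / c.
Proof.
move=> c0 t0.
have ce x : {for x, continuous (fun x => expR (c * x))}.
  apply: continuous_comp; last exact: continuous_expR.
  by apply: cvgMr; exact: cvg_id.
split.
  apply: continuous_compact_integrable; first exact: segment_compact.
  exact: continuous_subspaceT.
(* The fundamental theorem of calculus asks for a nondegenerate interval, so t = 0 is treated
   apart. *)
move: t0; rewrite le_eqVlt => /predU1P[<-|t0].
  by rewrite set_itv1 Rintegral_set1 mulr0 expR0 subrr mul0r.
pose F : R -> R := fun y => c^-1 * expR (c * y).
have dF (x : R) : is_derive x 1 F (expR (c * x)).
  have h1 : is_derive x 1 ( *%R c : R -> R) c.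
    by have := @is_deriveZ R R^o R^o id c x 1 1 _; rewrite /GRing.scale/= mulr1; apply.
  have h2 := is_derive1_comp (is_derive_expR (c * x)) h1.
  have := @is_deriveZ R R^o R^o (expR \o ( *%R c)) c^-1 x 1 _ h2; rewrite /GRing.scale/=.
  by rewrite mulrC mulfK// gt_eqF.
have -> : (expR (c * t) - 1) / c = F t - F 0.
  by rewrite /F mulr0 expR0; ring.
have cF x : {for x, continuous F}.
  by apply: differentiable_continuous; apply/derivable1_diffP; have [] := dF x.
rewrite /Rintegral (@continuous_FTC2 _ _ F)//.
- exact: continuous_subspaceT.
- split=> [x _||]; first by have [] := dF x.
    by apply: cvg_at_right_filter; exact: cF.
  by apply: cvg_at_left_filter; exact: cF.
- by move=> x _; rewrite derive1E; have [_ ->] := dF x.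
Qed.

End interval_analysis.

Section state_extra.
Context {R : realType}.
Implicit Types (s t T M : R) (U V : state R).

(** If a partial sum exceeded M^2, the bound at the midpoint of M and its square root would already
    fail. *)
Lemma XB_closed s U M : 0 <= M -> (forall e, 0 < e -> XB s U (M + e)) -> XB s U M.
Proof.
move=> M0 h; split=> // N; rewrite leNgt; apply/negP => MN.
have S0 : 0 <= psumZ (Xterm s U) N by apply: psumZ_ge0; exact: Xterm_ge0.
have M_lt : M < Num.sqrt (psumZ (Xterm s U) N).
  by rewrite -[ltLHS](ger0_norm M0) -sqrtr_sqr ltr_sqrt// (le_lt_trans (sqr_ge0 M) MN).
have [_ /(_ N)] : XB s U (M + (Num.sqrt (psumZ (Xterm s U) N) - M) / 2).
  by apply: h; rewrite divr_gt0// subr_gt0.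
apply/negP; rewrite -ltNge -[ltRHS](sqr_sqrtr S0) ltr_sqr ?nnegrE ?sqrtr_ge0//; lra.
Qed.

Lemma XB0_eq s U V : XB s (subX U V) 0 -> U = V.
Proof.
move=> UV; apply: (@coord_inj _ s) => j; apply/eqP; rewrite -subr_eq0 -coordB -normr_le0.
exact: coord_le UV.
Qed.

Lemma Xnorm_sub_le s U V : inX s U -> inX s V ->
  `|Xnorm s U - Xnorm s V| <= Xnorm s (subX U V).
Proof.
move=> hU hV; have hUV := inX_XB (inX_sub hU hV).
have h1 := XB_Xnorm (XB_le_sub (inX_XB hV) hUV).
have h2 := XB_Xnorm (XB_le_sub (inX_XB hU) (XB_subC hUV)).
by rewrite ler_norml; apply/andP; split; lra.
Qed.

(** Uniqueness concerns all mild solutions, not only those in the Picard ball; compactness of [0, T]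
    supplies each with a bound. *)
Lemma inCX_bounded s T (U : R -> state R) : 0 <= T -> inCX s T U ->
  exists M, forall t, 0 <= t <= T -> XB s (U t) M.
Proof.
move=> T0 [iU cU].
have [|M hM] := @continuous_itv_bounded _ T (fun t => Xnorm s (U t)) T0.
  apply/within_continuousP => t tT e e0; have [d d0 hd] := cU t tT e e0.
  exists d => // t' t'T t't; apply: le_lt_trans (hd t' t'T t't).
  by apply: Xnorm_sub_le; exact: iU.
by exists M => t tT; apply: le_XB (inX_XB (iU t tT)) (hM t tT).
Qed.

Lemma inCX_modulus s T (U : R -> state R) t : inCX s T U -> 0 <= t <= T ->
  forall e, 0 < e -> exists2 d, 0 < d & forall t', 0 <= t' <= T -> `|t' - t| < d ->
    XB s (subX (U t') (U t)) e.
Proof.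
move=> [iU cU] tT e e0; have [d d0 hd] := cU t tT e e0.
exists d => // t' t'T t't; apply: le_XB (ltW (hd t' t'T t't)).
by apply/inX_XB/inX_sub; exact: iU.
Qed.

Lemma modulus_inCX s T (U : R -> state R) :
  (forall t, 0 <= t <= T -> inX s (U t)) ->
  (forall t, 0 <= t <= T -> forall e, 0 < e -> exists2 d, 0 < d &
    forall t', 0 <= t' <= T -> `|t' - t| < d -> XB s (subX (U t') (U t)) e) ->
  inCX s T U.
Proof.
move=> iU cU; split=> // t tT e e0; have [|d d0 hd] := cU t tT (e / 2).
  by rewrite divr_gt0.
exists d => // t' t'T t't; apply: le_lt_trans (XB_Xnorm (hd t' t'T t't)) _; lra.
Qed.

End state_extra.

(** * The forcing term *)

Section forcing.
Context {R : realType}.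
Notation mu := (@lebesgue_measure R).
Implicit Types (s t T M : R) (f g : R -> fseq R).

Definition Hnorm_fun s f : R -> R := fun t => Hnorm s (f t).

Lemma Hterm_Jinv s (c : fseq R) k :
  Hterm s (fun k => Jinv k * c k) k = Hterm (s - 2) c k.
Proof.
rewrite !HtermE normcM normc_Jinv.
have -> : s - 2 = s - 1 - 1 by ring.
rewrite (swgt_pred s) (swgt_pred (s - 1)) -sqr_jap; congr (_ ^+ 2).
by field; rewrite gt_eqF ?jap_gt0.
Qed.

Lemma XB_Fsrc s (c : fseq R) M : XB s (Fsrc c) M <-> HB (s - 2) c M.
Proof.
rewrite -[Fsrc c]/(fst_state (fun k => Jinv k * c k)); split.
  move=> /XB_fst_state[M0 h]; split=> // N; rewrite (le_trans _ (h N))//.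
  by apply: le_psumZ => k; rewrite Hterm_Jinv.
move=> [M0 h]; apply/XB_fst_state; split=> // N; rewrite (le_trans _ (h N))//.
by apply: le_psumZ => k; rewrite Hterm_Jinv.
Qed.

Lemma real_state_Fsrc (c : fseq R) : realseq c -> real_state (Fsrc c).
Proof.
move=> rc; split=> k; last exact: (esym (conjc0 _)).
by rewrite /= rc /Jinv mulrNz sqrrN; apply: complexP; case: (c k) => a b /=; ring.
Qed.

Lemma Fsrc_sub (c d : fseq R) : subX (Fsrc c) (Fsrc d) = Fsrc (subS c d).
Proof.
rewrite /subX /Fsrc /subS/=; congr (_, _); apply/funext => k; last by rewrite subrr.
by rewrite mulrBr.
Qed.

(** The squared norm is a pointwise limit of finite sums, each measurable in time. *)
Lemma measurable_Hnorm s T f : (forall t, 0 <= t <= T -> inH s (f t)) ->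
  (forall k, measurable_fun `[0, T] (fun t => complex.Re (f t k)) /\
             measurable_fun `[0, T] (fun t => complex.Im (f t k))) ->
  measurable_fun `[0, T] (Hnorm_fun s f).
Proof.
move=> hf mf; apply: measurableT_comp.
  by apply: continuous_measurable_fun; exact: sqrt_continuous.
apply: (@measurable_fun_cvg _ _ _ _ (fun N t => psumZ (Hterm s (f t)) N)) => [N|t].
  have -> : (fun t => psumZ (Hterm s (f t)) N) =
      (fun t => \sum_(k <- window N) Hterm s (f t) k).
    by apply/funext => t; rewrite psumZE.
  apply: measurable_sum => k; apply: measurable_funM => //.
  by apply: measurable_funD; apply: measurable_funX; have [] := mf k.
by rewrite /= in_itv/= => /hf[_ c].
Qed.

Lemma inL1_source s T f : inL1 s T f ->
  source s T (fun t => Fsrc (f t)) (Hnorm_fun (s - 2) f) /\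
  forall t, 0 <= t <= T -> real_state (Fsrc (f t)).
Proof.
move=> [hf [mf If]]; split; last by move=> t /hf[rf _]; exact: real_state_Fsrc.
have mcoord (w : R) k : measurable_fun `[0, T] (fun t => w * complex.Re (f t k)) /\
    measurable_fun `[0, T] (fun t => w * complex.Im (f t k)).
  by split; apply: measurable_funM => //; have [] := mf k.
have mH := measurable_Hnorm hf mf.
split.
- move=> [k i]; case: i => [|[|i]]; rewrite /coord/=.
  + have -> : (fun t => swgt s k * complex.Re (Jinv k * f t k)) =
        (fun t => (swgt s k * (1 + k%:~R ^+ 2)^-1) * complex.Re (f t k)).
      by apply/funext => t; rewrite cReM/= mul0r subr0 mulrA.
    by have [] := mcoord (swgt s k * (1 + k%:~R ^+ 2)^-1) k.
  + have -> : (fun t => swgt s k * complex.Im (Jinv k * f t k)) =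
        (fun t => (swgt s k * (1 + k%:~R ^+ 2)^-1) * complex.Im (f t k)).
      by apply/funext => t; rewrite cImM/= mul0r addr0 mulrA.
    by have [] := mcoord (swgt s k * (1 + k%:~R ^+ 2)^-1) k.
  + by case: i => [|i]; exact: measurable_cst.
- apply/integrableP; split; first exact/measurable_EFinP.
  under eq_integral => t _ do rewrite /= ger0_norm ?sqrtr_ge0//.
  exact: If.
- move=> t /hf[_ c]; apply/XB_Fsrc; exact: cvg_HB.
Qed.

Lemma Hnorm_ge0 s (c : fseq R) : 0 <= Hnorm s c. Proof. exact: sqrtr_ge0. Qed.

Lemma L1norm_ge0 s T f : 0 <= L1norm s T f.
Proof. by apply: Rintegral_ge0 => t _; exact: Hnorm_ge0. Qed.

Lemma inL1_sub s T f g : inL1 s T f -> inL1 s T g -> inL1 s T (subF f g).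
Proof.
move=> hf hg.
have [[_ if' _] _] := inL1_source hf; have [[_ ig _] _] := inL1_source hg.
move: hf hg => [hf [mf _]] [hg [mg _]].
have hfg : forall t, 0 <= t <= T -> inH (s - 2) (subF f g t).
  move=> t tT; have [rf cf] := hf t tT; have [rg cg] := hg t tT; split.
    by move=> k; rewrite /subF /subS rf rg -raddfB.
  by apply: HB_cvg (HB_sub (cvg_HB cf) (cvg_HB cg)).
have mfg k : measurable_fun `[0, T] (fun t => complex.Re (subF f g t k)) /\
             measurable_fun `[0, T] (fun t => complex.Im (subF f g t k)).
  have [f1 f2] := mf k; have [g1 g2] := mg k; split.
    rewrite (_ : (fun t => _) = (fun t => complex.Re (f t k) - complex.Re (g t k))).
      exact: measurable_funB.
    by apply/funext => t; rewrite /subF /subS cReB.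
  rewrite (_ : (fun t => _) = (fun t => complex.Im (f t k) - complex.Im (g t k))).
    exact: measurable_funB.
  by apply/funext => t; rewrite /subF /subS cImB.
split=> //; split=> //.
have /integrableP[_] : mu.-integrable `[0, T] (EFin \o Hnorm_fun (s - 2) (subF f g)).
  apply: integrable_dom (integrable_add _ if' ig) _ => //.
    exact: measurable_Hnorm hfg mfg.
  move=> t; rewrite /= in_itv/= => tT; rewrite ger0_norm ?Hnorm_ge0//.
  by apply/HB_Hnorm/HB_sub; apply: cvg_HB; [have [] := hf t tT|have [] := hg t tT].
apply: le_lt_trans; rewrite le_eqVlt; apply/orP; left; apply/eqP.
by apply: eq_integral => t _; rewrite /= ger0_norm ?Hnorm_ge0.
Qed.

Lemma L1norm_triangle s T f g : inL1 s T f -> inL1 s T g ->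
  L1norm s T f <= L1norm s T g + L1norm s T (subF f g).
Proof.
move=> hf hg.
have [[_ jf _] _] := inL1_source hf; have [[_ jg _] _] := inL1_source hg.
have [[_ jfg _] _] := inL1_source (inL1_sub hf hg).
rewrite /L1norm -RintegralD//; apply: le_Rintegral => //; first exact: integrable_add.
move=> t; rewrite /= in_itv/= => tT.
have [_ cf] := hf.1 t tT; have [_ cg] := hg.1 t tT.
have [_ cfg] := (inL1_sub hf hg).1 t tT.
apply: HB_Hnorm; have := HB_add (cvg_HB cg) (cvg_HB cfg); congr (HB _ _ _).
by apply/funext => k; rewrite /subF /subS addrC subrK.
Qed.

End forcing.

Section sources.
Context {R : realType}.
Notation mu := (@lebesgue_measure R).
Implicit Types (s t T M : R) (H : R -> state R) (h : R -> R).

Lemma source_restrict s T T' H h : T' <= T -> source s T H h -> source s T' H h.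
Proof.
move=> T'T [mH ih Hh]; split.
- by move=> j; apply: measurable_funS (mH j) => //; exact: itv_sub.
- exact: integrable_itvS ih.
- by move=> x /andP[x0 xT]; apply: Hh; rewrite x0 (le_trans xT).
Qed.

Lemma duh_modulus s T H h t : source s T H h -> 0 <= t <= T ->
  forall e, 0 < e -> exists2 d, 0 < d & forall t', 0 <= t' <= T -> `|t' - t| < d ->
    XB s (subX (duh H t') (duh H t)) e.
Proof.
move=> sH tT e e0; have [_ ih Hh] := sH; have /andP[t0 tT'] := tT.
have T0 := le_trans t0 tT'.
have h0 x : 0 <= x <= T -> 0 <= h x by move=> /Hh[].
pose I := \int[mu]_(x in `[0, T]) h x.
have I0 : 0 <= I by apply: Rintegral_ge0 => x; rewrite /= in_itv/=; exact: h0.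
have e2 : 0 < e / 2 by rewrite divr_gt0.
have [d1 d10 hd1] := Rintegral_itv_continuous T0 ih tT e2.
(* The 1 added to the total mass I keeps the denominator positive. *)
have d20 : 0 < e / 2 / (I + 1) by rewrite divr_gt0// ltr_wpDl.
exists (Num.min d1 (e / 2 / (I + 1))); first by rewrite lt_min d10.
(* [XB_duh_time] speaks of ordered times; both orders of t and t' reduce to this case. *)
have key u v : 0 <= u -> u <= v -> v <= T -> v - u < e / 2 / (I + 1) ->
    `|\int[mu]_(x in `[0, v]) h x - \int[mu]_(x in `[0, u]) h x| < e / 2 ->
    XB s (subX (duh H v) (duh H u)) e.
  move=> u0 uv vT vu huv; apply: le_XB (XB_duh_time sH u0 uv vT) _.
  have [Iu Iu'] : 0 <= \int[mu]_(x in `[0, u]) h x /\ \int[mu]_(x in `[0, u]) h x <= I.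
    have uT := le_trans uv vT; split; last exact: Rintegral_itv_le.
    apply: Rintegral_ge0 => x; rewrite /= in_itv/= => /andP[x0 xu].
    by apply: h0; rewrite x0 (le_trans xu).
  have : (v - u) * \int[mu]_(x in `[0, u]) h x <= e / 2.
    apply: (@le_trans _ _ ((v - u) * (I + 1))).
      by rewrite ler_wpM2l ?subr_ge0// (le_trans Iu')// lerDl.
    by rewrite -ler_pdivlMr ?ltr_wpDl// ltW.
  move=> h2; rewrite [leRHS](splitr e) lerD//.
  exact/ltW/(le_lt_trans (ler_norm _) huv).
move=> t' /andP[t'0 t'T]; rewrite lt_min => /andP[tt1 tt2].
have [tt'|t't] := leP t t'.
  apply: key => //; first by rewrite ger0_norm ?subr_ge0// in tt2.
  by apply: hd1 => //; rewrite t'0.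
apply: XB_subC; apply: key => //; first exact: ltW.
  by rewrite distrC ger0_norm ?subr_ge0// ?(ltW t't) in tt2.
by rewrite distrC; apply: hd1 => //; rewrite t'0.
Qed.

Lemma expA_modulus s T U0 M t : XB s U0 M -> 0 <= t <= T ->
  forall e, 0 < e -> exists2 d, 0 < d & forall t', 0 <= t' <= T -> `|t' - t| < d ->
    XB s (subX (expA t' U0) (expA t U0)) e.
Proof.
move=> UM _ e e0; have M0 := UM.1.
exists (e / (M + 1)); first by rewrite divr_gt0// ltr_wpDl.
move=> t' _ tt'; apply: le_XB (XB_expA_time t' t UM) _.
apply: (@le_trans _ _ (`|t' - t| * (M + 1))); first by rewrite ler_wpM2l// lerDl.
by rewrite -ler_pdivlMr ?ltr_wpDl// ltW.
Qed.

Lemma XB_sub_comb s (E E' G G' F F' : state R) a b c :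
  XB s (subX E E') a -> XB s (subX G G') b -> XB s (subX F F') c ->
  XB s (subX (addX (subX E G) F) (addX (subX E' G') F')) (a + b + c).
Proof.
move=> hE hG hF; have := XB_add (XB_sub hE hG) hF; congr (XB s _ _).
by apply: (@coord_inj _ s) => j; rewrite !(coordD, coordB); ring.
Qed.

End sources.

(** * The fixed-point problem *)

Section fixed_point_map.
Context {R : realType}.
Notation mu := (@lebesgue_measure R).
Implicit Types (t T M a : R) (U V : R -> state R) (f g : R -> fseq R).
Variables (s : R) (p : nat).
Hypotheses (p1 : (1 <= p)%N) (hs1 : p = 1%N -> 0 <= s) (hsp : (1 < p)%N -> 2^-1 < s).
Variable (K : R).
Hypotheses (K0 : 0 <= K) (hK : forall (U V : state R) M D,
  XB s U M -> XB s V M -> XB s (subX U V) D ->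
  XB s (Gnl p U) (K * M ^+ p.+1) /\
  XB s (subX (Gnl p U) (Gnl p V)) (K * (M ^+ p * D))).

Definition Phi (U0 : state R) f U t : state R :=
  addX (subX (expA t U0) (duh (fun x => Gnl p (U x)) t)) (duh (fun x => Fsrc (f x)) t).

Lemma mildP T (U0 : state R) f U : mild s p T U0 f U <->
  inCX s T U /\ forall t, 0 <= t <= T -> U t = Phi U0 f U t.
Proof.
split=> -[cU hU]; split=> // t tT.
  have h := hU t tT; case E : (U t) => [u v]; rewrite E in h.
  by congr (_, _); apply/funext => k; have [] := h k.
by move=> k; have e := hU t tT; split; rewrite {1}e.
Qed.

Lemma XB_Gnl (U : state R) M : XB s U M -> XB s (Gnl p U) (K * M ^+ p.+1).
Proof. by move=> UM; have [] := hK UM UM (XB_sub UM UM). Qed.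

Lemma Gnl_source T U M : inCX s T U -> (forall t, 0 <= t <= T -> XB s (U t) M) ->
  source s T (fun x => Gnl p (U x)) (fun=> K * M ^+ p.+1).
Proof.
move=> cU UM; split; last 2 first.
- exact: integrable_cst.
- by move=> x /UM; exact: XB_Gnl.
(* Measurability comes from continuity: U is continuous into X^s and G is Lipschitz on the ball. *)
move=> j; apply: continuous_itv_measurable; apply/within_continuousP => t tT e e0.
have M0 : 0 <= M by have [] := UM t tT.
have C0 : 0 <= K * M ^+ p by rewrite mulr_ge0// exprn_ge0.
have [|d d0 hd] := inCX_modulus cU tT (e := e / (K * M ^+ p + 1)).
  by rewrite divr_gt0// ltr_wpDl.
exists d => // t' t'T tt'; rewrite -coordB.
have [_ h] := hK (UM t' t'T) (UM t tT) (hd t' t'T tt').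
apply: le_lt_trans (coord_le j h) _.
by rewrite !mulrA ltr_pdivrMr ?ltr_wpDl// mulrC ltr_pM2l// ltrDl.
Qed.

Lemma Phi_real T (U0 : state R) f U M t : 0 <= t <= T -> inX s U0 -> inL1 s T f ->
  inCX s T U -> (forall t, 0 <= t <= T -> XB s (U t) M) -> real_state (Phi U0 f U t).
Proof.
move=> tT iU0 hf cU UM; have [sf rf] := inL1_source hf; have sG := Gnl_source cU UM.
apply: real_state_add; last exact: real_state_duh sf tT rf.
apply: real_state_sub; first exact: real_state_expA (inX_real iU0).
apply: real_state_duh sG tT _ => x xT.
by apply: real_state_Gnl (UM x xT) (inX_real (cU.1 x xT)).
Qed.

Lemma inL1_restrict T Ts f : T <= Ts -> inL1 s Ts f -> inL1 s T f.
Proof.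
move=> TT hf; have [/(source_restrict TT)[_ ih _] _] := inL1_source hf.
case: hf => hf [mf _]; split=> [t /andP[t0 tT]|].
  by apply: hf; rewrite t0 (le_trans tT).
split=> [k|]; first by have [m1 m2] := mf k; split;
  (apply: measurable_funS; [| |by eassumption]) => //; exact: itv_sub.
move/integrableP : ih => [_]; apply: le_lt_trans; rewrite le_eqVlt.
by apply/orP; left; apply/eqP/eq_integral => t _; rewrite /= ger0_norm ?Hnorm_ge0.
Qed.

Lemma Phi_bound T (U0 : state R) f U M t a : 0 <= t <= T -> XB s U0 a -> inL1 s T f ->
  inCX s T U -> (forall t, 0 <= t <= T -> XB s (U t) M) ->
  XB s (Phi U0 f U t) (a + K * M ^+ p.+1 * T + L1norm s T f).
Proof.
move=> tT aU0 hf cU UM; have [sf _] := inL1_source hf; have sG := Gnl_source cU UM.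
have /andP[t0 tT'] := tT.
have M0 : 0 <= M by have [] := UM t tT.
apply: XB_add.
  apply: XB_sub; first exact: XB_expA.
  apply: le_XB (XB_duh sG tT) _; rewrite Rintegral_itv_cst//.
  by rewrite ler_wpM2l// mulr_ge0// exprn_ge0.
apply: le_XB (XB_duh sf tT) _; apply: Rintegral_itv_le => //.
  by have [] := sf.
by move=> x _; exact: Hnorm_ge0.
Qed.

Lemma Phi_inCX T (U0 : state R) f U M : inX s U0 -> inL1 s T f ->
  inCX s T U -> (forall t, 0 <= t <= T -> XB s (U t) M) -> inCX s T (Phi U0 f U).
Proof.
move=> iU0 hf cU UM; have [sf _] := inL1_source hf; have sG := Gnl_source cU UM.
apply: modulus_inCX => t tT.
  apply: XB_inX (Phi_real tT iU0 hf cU UM) _.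
  exact: Phi_bound tT (inX_XB iU0) hf cU UM.
move=> e e0; have e3 : 0 < e / 3 by rewrite divr_gt0.
have [d1 d10 h1] := expA_modulus (inX_XB iU0) tT e3.
have [d2 d20 h2] := duh_modulus sG tT e3.
have [d3 d30 h3] := duh_modulus sf tT e3.
exists (Num.min d1 (Num.min d2 d3)); first by rewrite !lt_min d10 d20.
move=> t' t'T; rewrite !lt_min => /and3P[t1 t2 t3].
apply: le_XB (XB_sub_comb (h1 t' t'T t1) (h2 t' t'T t2) (h3 t' t'T t3)) _; lra.
Qed.

(** The majorant D of the distance stays a function of time: constant for the contraction,
    exponential for the dependence on the data. *)
Lemma Phi_diff T (U0 V0 : state R) f g U V M D t a :
  0 <= t <= T -> XB s (subX U0 V0) a -> inL1 s T f -> inL1 s T g ->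
  inCX s T U -> inCX s T V ->
  (forall t, 0 <= t <= T -> XB s (U t) M) -> (forall t, 0 <= t <= T -> XB s (V t) M) ->
  mu.-integrable `[0, t] (EFin \o D) ->
  (forall x, 0 <= x <= t -> XB s (subX (U x) (V x)) (D x)) ->
  XB s (subX (Phi U0 f U t) (Phi V0 g V t))
    (a + K * M ^+ p * \int[mu]_(x in `[0, t]) D x + L1norm s T (subF f g)).
Proof.
move=> tT aUV hf hg cU cV UM VM iD UVD.
have [sf _] := inL1_source hf; have [sg _] := inL1_source hg.
have sU := Gnl_source cU UM; have sV := Gnl_source cV VM.
have /andP[t0 tT'] := tT; have tt : 0 <= t <= t by rewrite t0 lexx.
apply: XB_sub_comb; first by rewrite expA_sub; exact: XB_expA.
  rewrite (duh_sub sU sV tT) -RintegralZl//.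
  apply: XB_duh tt; split.
  - by have [] := source_restrict tT' (source_sub sU sV).
  - exact: integrable_scale.
  - move=> x xt; rewrite -mulrA.
    have xT : 0 <= x <= T by case/andP: xt => -> xt; rewrite (le_trans xt).
    by have [] := hK (UM x xT) (VM x xT) (UVD x xt).
rewrite (duh_sub sf sg tT).
have [sfg _] := inL1_source (inL1_sub hf hg).
apply: (@le_XB _ s _ (\int[mu]_(x in `[0, t]) Hnorm_fun (s - 2) (subF f g) x)).
  have -> : (fun x => subX (Fsrc (f x)) (Fsrc (g x))) = (fun x => Fsrc (subF f g x)).
    by apply/funext => x; exact: Fsrc_sub.
  exact: XB_duh sfg tT.
by apply: Rintegral_itv_le => // [|x _]; [have [] := sfg|exact: Hnorm_ge0].
Qed.

End fixed_point_map.

Section limits.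
Context {R : realType}.
Implicit Types (s c e : R).

Lemma geometric_small c e : 0 < e -> exists n, forall m, (n <= m)%N -> c * 2^-1 ^+ m <= e.
Proof.
move=> e0; have h : `|2^-1 : R| < 1 by rewrite ger0_norm ?invr_ge0// invf_lt1// ltr1n.
have /cvgrPdist_le /(_ e e0) [n _ hn] := @cvg_geometric R c _ h.
exists n => m nm; have := hn m nm; rewrite sub0r normrN; exact: le_trans (ler_norm _).
Qed.

(** The increments form an absolutely convergent telescoping series. *)
Lemma cvg_geometric_increments (x : nat -> R) c :
  (forall n, `|x n.+1 - x n| <= c * 2^-1 ^+ n) -> cvgn x.
Proof.
move=> hx; have h : `|2^-1 : R| < 1 by rewrite ger0_norm ?invr_ge0// invf_lt1// ltr1n.
have cs : cvgn (series (fun n => x n.+1 - x n)).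
  apply: normed_cvg; apply: (@series_le_cvg _ _ (geometric c 2^-1)).
  - by move=> n; exact: normr_ge0.
  - by move=> n; apply: le_trans (hx n).
  - exact: hx.
  - exact: is_cvg_geometric_series.
have -> : x = (fun n => series (fun n => x n.+1 - x n) n + x 0%N).
  by apply/funext => n; rewrite /series/= telescope_sumr// subrK.
by apply: is_cvgD => //; exact: is_cvg_cst.
Qed.

(* The state whose [coord]s are prescribed; [coord] ignores the second index above 3. *)
Definition state_of_coord s (y : int * nat -> R) : state R :=
  (fun k => Complex (y (k, 0%N) / swgt s k) (y (k, 1%N) / swgt s k),
   fun k => Complex (y (k, 2%N) / swgt (s - 1) k) (y (k, 3%N) / swgt (s - 1) k)).

Lemma coord_state_of_coord s y (k : int) i :
  coord s (state_of_coord s y) (k, i) = y (k, minn i 3).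
Proof.
have w1 : swgt s k != 0 := lt0r_neq0 (swgt_gt0 s k).
have w2 : swgt (s - 1) k != 0 := lt0r_neq0 (swgt_gt0 (s - 1) k).
by case: i => [|[|[|i]]]; rewrite /coord/= mulrC divfK.
Qed.

Lemma coord_min3 s (U : state R) (k : int) i : coord s U (k, i) = coord s U (k, minn i 3).
Proof. by case: i => [|[|[|i]]]. Qed.

(** Stands in for completeness of X^s: coordinates converge here, and [XB_lim] transfers the norm
    bounds. *)
Lemma state_limit s (Un : nat -> state R) (c : R) :
  (forall n, XB s (subX (Un n.+1) (Un n)) (c * 2^-1 ^+ n)) ->
  exists U, forall j, coord s (Un n) j @[n --> \oo] --> coord s U j.
Proof.
move=> hU.
have cU j : cvgn (fun n => coord s (Un n) j).
  by apply: (@cvg_geometric_increments _ c) => n; rewrite -coordB; exact: coord_le.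
exists (state_of_coord s (fun j => lim (coord s (Un n) j @[n --> \oo]))) => -[k i].
rewrite coord_state_of_coord.
have -> : (fun n => coord s (Un n) (k, i)) = (fun n => coord s (Un n) (k, minn i 3)).
  by apply/funext => n; exact: coord_min3.
exact: cU.
Qed.

Lemma real_state_lim s (Un : nat -> state R) U :
  (forall n, real_state (Un n)) ->
  (forall j, coord s (Un n) j @[n --> \oo] --> coord s U j) -> real_state U.
Proof.
move=> rU cU; apply/(real_state_coord s) => k i.
rewrite -(cvg_lim _ (cU (- k, i)))//; apply: cvg_lim => //.
have -> : (fun n => coord s (Un n) (- k, i)) = (fun n => parity i * coord s (Un n) (k, i)).
  by apply/funext => n; have /(real_state_coord s)-> := rU n.
by apply: cvgMr; exact: cU.
Qed.

Lemma XB_subxx s (U : state R) : XB s (subX U U) 0.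
Proof.
apply/XB_coord; split=> // N; rewrite expr0n/= big1// => j _.
by rewrite coordB subrr expr0n.
Qed.

Lemma L1norm_subxx s T (f : R -> fseq R) : L1norm s T (subF f f) = 0.
Proof.
rewrite /L1norm (_ : (fun t => _) = (fun=> 0)).
  by rewrite Rintegral_cst// mul0r.
apply/funext => t; apply/eqP; rewrite eq_le Hnorm_ge0 andbT; apply: HB_Hnorm.
by apply/XB_Fsrc; rewrite -Fsrc_sub; exact: XB_subxx.
Qed.

End limits.

(** * Existence, dependence on the data and uniqueness *)

Section well_posedness.
Context {R : realType}.
Notation mu := (@lebesgue_measure R).
Implicit Types (t T M a e : R) (U V : R -> state R) (f g : R -> fseq R).
Variables (s : R) (p : nat).
Hypotheses (p1 : (1 <= p)%N) (hs1 : p = 1%N -> 0 <= s) (hsp : (1 < p)%N -> 2^-1 < s).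
Variable (K : R).
Hypotheses (K0 : 0 <= K) (hK : forall (U V : state R) M D,
  XB s U M -> XB s V M -> XB s (subX U V) D ->
  XB s (Gnl p U) (K * M ^+ p.+1) /\
  XB s (subX (Gnl p U) (Gnl p V)) (K * (M ^+ p * D))).

Lemma Phi_lip T (U0 : state R) f U V M c t : 0 <= t <= T ->
  inL1 s T f -> inCX s T U -> inCX s T V ->
  (forall t, 0 <= t <= T -> XB s (U t) M) -> (forall t, 0 <= t <= T -> XB s (V t) M) ->
  (forall t, 0 <= t <= T -> XB s (subX (U t) (V t)) c) ->
  XB s (subX (Phi p U0 f U t) (Phi p U0 f V t)) (K * M ^+ p * T * c).
Proof.
move=> tT hf cU cV UM VM UV; have /andP[t0 tT'] := tT.
have M0 : 0 <= M by have [] := UM t tT.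
have c0 : 0 <= c by have [] := UV t tT.
have UVt x : 0 <= x <= t -> XB s (subX (U x) (V x)) c.
  by move=> /andP[x0 xt]; apply: UV; rewrite x0 (le_trans xt).
have := Phi_diff K0 hK tT (XB_subxx s U0) hf hf cU cV UM VM (integrable_cst t c) UVt.
rewrite L1norm_subxx add0r addr0 Rintegral_itv_cst// => h; apply: le_XB h _.
rewrite -[leRHS]mulrA ler_wpM2l ?mulr_ge0 ?exprn_ge0//.
by rewrite mulrC ler_wpM2r.
Qed.

(** Half of the radius is reserved for the data and half for the nonlinearity. The same smallness of
    T makes the map preserve the ball and contract with ratio 1/2. *)
Lemma picard T (U0 : state R) f rho a : 0 <= T -> inX s U0 -> inL1 s T f ->
  XB s U0 a -> a + L1norm s T f <= rho / 2 -> K * rho ^+ p * T <= 2^-1 ->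
  exists U, mild s p T U0 f U /\ forall t, 0 <= t <= T -> XB s (U t) rho.
Proof.
move=> T0 iU0 hf aU0 arho small.
have rho0 : 0 <= rho.
  have := aU0.1; have := L1norm_ge0 s T f; lra.
pose Un n : R -> state R := iter n (Phi p U0 f) (fun=> (fun=> 0, fun=> 0)).
have inv n : inCX s T (Un n) /\ forall t, 0 <= t <= T -> XB s (Un n t) rho.
  elim: n => [|n [cn bn]].
    have z : XB s ((fun=> 0, fun=> 0) : state R) rho.
      apply: le_XB rho0; have := XB_subxx s U0; congr (XB s _ _).
      by rewrite /subX /subS; congr (_, _); apply/funext => k; rewrite subrr.
    split; last by move=> t _; exact: z.
    apply: modulus_inCX => [t tT|t tT e e0].
      by apply: XB_inX z; split=> k; exact: (esym (conjc0 _)).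
    by exists 1 => // t' _ _; apply: le_XB (XB_subxx s _) (ltW e0).
  split; first exact: (Phi_inCX p1 hs1 hsp K0 hK iU0 hf cn bn).
  move=> t tT; apply: le_XB (Phi_bound K0 hK tT aU0 hf cn bn) _.
  have : K * rho ^+ p.+1 * T <= 2^-1 * rho.
    by rewrite exprSr mulrA mulrAC ler_wpM2r.
  lra.
have diff n : forall t, 0 <= t <= T ->
    XB s (subX (Un n.+1 t) (Un n t)) ((rho + rho) * 2^-1 ^+ n).
  elim: n => [|n IH] t tT.
    by rewrite expr0 mulr1; apply: XB_sub; [apply: (inv 1%N).2|apply: (inv 0%N).2].
  have := Phi_lip U0 tT hf (inv n.+1).1 (inv n).1 (inv n.+1).2 (inv n).2 IH.
  move=> h; apply: le_XB h _; rewrite exprS [leRHS]mulrCA ler_wpM2r//.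
  by rewrite mulr_ge0 ?addr_ge0// exprn_ge0// invr_ge0.
(* The exact partial sum of the increments 2 rho 2^-i for i from n to n+m-1. *)
have far n m t : 0 <= t <= T -> XB s (subX (Un (n + m)%N t) (Un n t))
    (4 * rho * (2^-1 ^+ n - 2^-1 ^+ (n + m))).
  move=> tT; elim: m => [|m IH].
    by rewrite addn0 subrr mulr0; exact: XB_subxx.
  rewrite addnS; have := XB_trans (diff (n + m)%N t tT) IH; congr (XB s _ _).
  by rewrite exprS; field.
have lim_ex t : 0 <= t <= T -> {Ut : state R |
    forall j, coord s (Un n t) j @[n --> \oo] --> coord s Ut j}.
  by move=> tT; apply: cid; apply: state_limit => n; exact: diff.
(* Outside [0, T] the value is an arbitrary default. *)
pose U t := match pselect (0 <= t <= T) with left h => sval (lim_ex t h)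
            | right _ => U0 end.
have cU t : 0 <= t <= T -> forall j, coord s (Un n t) j @[n --> \oo] --> coord s (U t) j.
  by move=> tT; rewrite /U; case: pselect => // h; exact: (svalP (lim_ex t h)).
have UM t : 0 <= t <= T -> XB s (U t) rho.
  move=> tT; apply: XB_lim (cU t tT) => //.
  by apply: nearW => n; exact: (inv n).2.
(* Lower semicontinuity applied to the differences gives convergence uniform in t, hence continuity
   of U. *)
have Udist n t : 0 <= t <= T -> XB s (subX (U t) (Un n t)) (4 * rho * 2^-1 ^+ n).
  move=> tT; apply: (@XB_lim _ s (fun m => subX (Un m t) (Un n t))).
  - by rewrite !mulr_ge0// exprn_ge0// invr_ge0.
  - near=> m; have nm : (n <= m)%N by near: m; exact: nbhs_infty_ge.
    rewrite -(subnKC nm); apply: le_XB (far n (m - n)%N t tT) _.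
    by rewrite ler_wpM2l ?mulr_ge0// lerBlDr lerDl exprn_ge0// invr_ge0.
  - move=> j; rewrite coordB.
    have -> : (fun m => coord s (subX (Un m t) (Un n t)) j) =
        (fun m => coord s (Un m t) j - coord s (Un n t) j).
      by apply/funext => m; rewrite coordB.
    by apply: cvgB; [exact: cU|exact: cvg_cst].
have Ucont : inCX s T U.
  apply: modulus_inCX => [t tT|t tT e e0].
    apply: XB_inX (UM t tT); apply: real_state_lim (cU t tT) => n.
    exact: inX_real ((inv n).1.1 t tT).
  have e3 : 0 < e / 3 by rewrite divr_gt0.
  have [n hn] := geometric_small (4 * rho) e3.
  have [d d0 hd] := inCX_modulus (inv n).1 tT e3.
  exists d => // t' t'T tt'.
  have h := XB_trans (XB_trans (Udist n t' t'T) (hd t' t'T tt')) (XB_subC (Udist n t tT)).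
  apply: le_XB h _; have := hn n (leqnn n); lra.
exists U; split=> //; apply/mildP; split=> // t tT.
apply: (@XB0_eq _ s); apply: XB_closed => // e e0; rewrite add0r.
have [n hn] := geometric_small (4 * rho) e0.
(* The iterate n+1 is Phi of iterate n: it is within 4 rho 2^-(n+1) of U, and by contraction within
   the same distance of Phi U. *)
have := XB_trans (Udist n.+1 t tT)
  (XB_subC (Phi_lip U0 tT hf Ucont (inv n).1 UM (inv n).2 (Udist n))).
move=> h; apply: le_XB h _; apply: le_trans (hn n (leqnn n)).
have q0 : 0 <= 4 * rho * 2^-1 ^+ n by rewrite !mulr_ge0// exprn_ge0// invr_ge0.
have : K * rho ^+ p * T * (4 * rho * 2^-1 ^+ n) <= 2^-1 * (4 * rho * 2^-1 ^+ n).
  by rewrite ler_wpM2r.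
have -> : 4 * rho * 2^-1 ^+ n.+1 = 2^-1 * (4 * rho * 2^-1 ^+ n) by rewrite exprS; ring.
move: q0; move: (4 * rho * _) (K * _ * _ * _) => x y; lra.
Unshelve. all: by end_near. Qed.

(* Each pass through the Duhamel formula halves the excess over [2 (a + |f - g|)]
   in the norm weighted by [exp (- 2 L t)]. *)
Lemma mild_dependence T (U0 V0 : state R) f g U V M a : 0 <= T ->
  XB s (subX U0 V0) a -> inL1 s T f -> inL1 s T g ->
  mild s p T U0 f U -> mild s p T V0 g V ->
  (forall t, 0 <= t <= T -> XB s (U t) M) -> (forall t, 0 <= t <= T -> XB s (V t) M) ->
  forall t, 0 <= t <= T -> XB s (subX (U t) (V t))
    (2 * (a + L1norm s T (subF f g)) * expR (2 * (K * M ^+ p + 1) * t)).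
Proof.
move=> T0 aUV hf hg /mildP[cU eU] /mildP[cV eV] UM VM.
have M0 : 0 <= M by have [|] := UM 0; rewrite ?lexx.
have L0 : 0 <= K * M ^+ p by rewrite mulr_ge0// exprn_ge0.
(* With this rate K M^p / c <= 1/2, the source of the halving; the 1 makes c positive. *)
set c := 2 * (K * M ^+ p + 1); have c0 : 0 < c by rewrite mulr_gt0// ltr_wpDl.
set A := a + L1norm s T (subF f g).
have A0 : 0 <= A by rewrite addr_ge0 ?L1norm_ge0//; exact: aUV.1.
have exp1 t : 0 <= t -> 1 <= expR (c * t).
  by move=> t0; rewrite -expR0 ler_expR mulr_ge0// ltW.
(* 2A is the fixed point of x -> A + x/2; the initial excess 2M is the crude bound on the
   distance. *)
have claim n : forall t, 0 <= t <= T ->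
    XB s (subX (U t) (V t)) ((2 * A + (M + M) * 2^-1 ^+ n) * expR (c * t)).
  elim: n => [|n IH] t tT; have /andP[t0 tT'] := tT.
    apply: le_XB (XB_sub (UM t tT) (VM t tT)) _; rewrite expr0 mulr1.
    have := exp1 t t0; nra.
  have [ie Ie] := Rintegral_expR c0 t0.
  have iS : mu.-integrable `[0, t]
      (EFin \o (fun x => (2 * A + (M + M) * 2^-1 ^+ n) * expR (c * x))).
    exact: integrable_scale.
  have := Phi_diff K0 hK tT aUV hf hg cU cV UM VM iS.
  rewrite -(eU t tT) -(eV t tT) => h; apply: le_XB.
    apply: h => x /andP[x0 xt]; apply: IH; by rewrite x0 (le_trans xt).
  rewrite RintegralZl// Ie exprS.
  have := exp1 t t0; set E := expR _ => E1.
  set S := 2 * A + (M + M) * 2^-1 ^+ n.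
  have S0 : 0 <= S.
    have q0 : 0 <= 2^-1 ^+ n :> R by rewrite exprn_ge0// invr_ge0.
    by apply: addr_ge0; apply: mulr_ge0 => //; exact: addr_ge0.
  have : K * M ^+ p * (S * ((E - 1) / c)) <= S / 2 * (E - 1).
    have -> : S / 2 * (E - 1) = (K * M ^+ p + 1) * (S * ((E - 1) / c)).
      by rewrite /c; field; rewrite gt_eqF// ltr_wpDl.
    apply: ler_wpM2r; last by rewrite lerDl.
    by rewrite mulr_ge0// divr_ge0 ?subr_ge0// ltW.
  rewrite addrAC -/A.
  have -> : (2 * A + (M + M) * (2^-1 * 2^-1 ^+ n)) * E = (A + S / 2) * E.
    by rewrite /S; field.
  nra.
move=> t tT; have /andP[t0 _] := tT; apply: XB_closed => [|e e0].
  by rewrite !mulr_ge0// expR_ge0.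
have [n hn] := geometric_small ((M + M) * expR (c * t)) e0.
apply: le_XB (claim n t tT) _.
by rewrite mulrDl lerD2l mulrAC; exact: hn.
Qed.

Lemma mild_unique T (U0 : state R) f U V : 0 <= T -> inL1 s T f ->
  mild s p T U0 f U -> mild s p T U0 f V -> forall t, 0 <= t <= T -> U t = V t.
Proof.
move=> T0 hf mU mV t tT; apply: (@XB0_eq _ s).
have [M UM] := inCX_bounded T0 mU.1; have [M' VM] := inCX_bounded T0 mV.1.
(* The dependence estimate wants one bound for both solutions; with equal data its right side is 0,
   whatever the bound. *)
pose N := Num.max M M'.
have UN x : 0 <= x <= T -> XB s (U x) N.
  by move=> /UM h; apply: le_XB h _; rewrite le_max lexx.
have VN x : 0 <= x <= T -> XB s (V x) N.
  by move=> /VM h; apply: le_XB h _; rewrite le_max lexx orbT.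
have := mild_dependence T0 (XB_subxx s U0) hf hf mU mV UN VN tT.
by rewrite L1norm_subxx addr0 mulr0 mul0r.
Qed.

End well_posedness.

Theorem theorem2p3 (R : realType) (Ts : R) (p : nat) (s : R) :
  0 < Ts -> (1 <= p)%N ->
  (p = 1%N -> 0 <= s) -> ((1 < p)%N -> 2^-1 < s) ->
  exists Tf : R -> R -> R,
    (forall a b : R, 0 < Tf a b <= Ts) /\
    forall (U0 : state R) (f : R -> fseq R),
      inX s U0 -> inL1 s Ts f ->
      let T := Tf (Xnorm s U0) (L1norm s Ts f) in
      (exists U : R -> state R, mild s p T U0 f U) /\
      (forall U V : R -> state R, mild s p T U0 f U -> mild s p T U0 f V ->
         forall t, 0 <= t <= T -> U t = V t) /\
      (forall T1 : R, 0 < T1 < T ->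
         exists delta : R, 0 < delta /\ exists L : R,
           (forall (U0' : state R) (f' : R -> fseq R),
              inX s U0' -> inL1 s Ts f' ->
              Xnorm s (subX U0' U0) + L1norm s Ts (subF f' f) < delta ->
              exists U' : R -> state R, mild s p T1 U0' f' U') /\
           (forall (U01 U02 : state R) (f1 f2 : R -> fseq R) (W1 W2 : R -> state R),
              inX s U01 -> inL1 s Ts f1 ->
              Xnorm s (subX U01 U0) + L1norm s Ts (subF f1 f) < delta ->
              inX s U02 -> inL1 s Ts f2 ->
              Xnorm s (subX U02 U0) + L1norm s Ts (subF f2 f) < delta ->
              mild s p T1 U01 f1 W1 -> mild s p T1 U02 f2 W2 ->
              forall t, 0 <= t <= T1 ->
                Xnorm s (subX (W1 t) (W2 t)) <=
                L * (Xnorm s (subX U01 U02) + L1norm s Ts (subF f1 f2)))).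
Proof.
move=> Ts0 p1 hs1 hsp; have [K K0 hK] := Gnl_lip p1 hs1 hsp.
(* Absolute values, because [Tf] must take values in ]0, Ts] at all real arguments. *)
pose rho (a b : R) : R := 2 * (`|a| + `|b| + 1).
have rho0 a b : 0 <= rho a b by rewrite mulr_ge0// !addr_ge0.
have C0 a b : 0 <= K * rho a b ^+ p by rewrite mulr_ge0// exprn_ge0.
have D0 a b : 0 < 2 * (K * rho a b ^+ p + 1) by rewrite mulr_gt0// ltr_wpDl.
(* With C = K rho^p, a time T <= 1/(2(C+1)) gives C T <= 1/2, also when C = 0. *)
exists (fun a b => Num.min Ts (2 * (K * rho a b ^+ p + 1))^-1); split=> [a b|].
  by rewrite lt_min Ts0 invr_gt0 D0 ge_min lexx.
move=> U0 f iU0 hf T.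
set a := Xnorm s U0 in T *; set b := L1norm s Ts f in T *.
have a0 : 0 <= a by exact: Xnorm_ge0.
have b0 : 0 <= b by exact: L1norm_ge0.
have rhoE : rho a b / 2 = a + b + 1.
  by rewrite /rho !ger0_norm//; field.
have T0 : 0 < T by rewrite lt_min Ts0 invr_gt0 D0.
have TTs : T <= Ts by rewrite ge_min lexx.
have small t : 0 <= t <= T -> K * rho a b ^+ p * t <= 2^-1.
  move=> /andP[t0 tT]; have : t <= (2 * (K * rho a b ^+ p + 1))^-1.
    by apply: le_trans tT _; rewrite ge_min lexx orbT.
  rewrite -(ler_pM2l (D0 a b)) mulfV ?gt_eqF//.
  have := C0 a b; move: (K * _ ^+ p) => C; nra.
have L1T t (g : R -> fseq R) : 0 <= t <= T -> inL1 s Ts g -> L1norm s t g <= L1norm s Ts g.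
  move=> /andP[t0 tT] hg; have [[_ ih _] _] := inL1_source hg.
  apply: Rintegral_itv_le => //; first exact: le_trans TTs.
  by move=> x _; exact: Hnorm_ge0.
have rst t (g : R -> fseq R) : t <= T -> inL1 s Ts g -> inL1 s t g.
  by move=> tT; apply: inL1_restrict; exact: le_trans TTs.
(* Data within distance 1 have total size at most a + b + 1 = rho/2, so one radius and one time
   serve them all. The result also records that the solution stays in the ball. *)
have near_ex t (V0 : state R) (g : R -> fseq R) : 0 <= t <= T -> inX s V0 -> inL1 s Ts g ->
    Xnorm s (subX V0 U0) + L1norm s Ts (subF g f) < 1 ->
    exists V, mild s p t V0 g V /\ forall x, 0 <= x <= t -> XB s (V x) (rho a b).
  move=> tT iV0 hg close; have /andP[t0 tT'] := tT.
  have hV0 := XB_le_sub (inX_XB iU0) (inX_XB (inX_sub iV0 iU0)).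
  apply: (picard p1 hs1 hsp K0 hK t0 iV0 (rst _ _ tT' hg) hV0 _ (small t tT)).
  have h1 := L1T t g tT hg; have h2 := L1norm_triangle hg hf.
  rewrite rhoE; move: close h1 h2; rewrite -/a -/b.
  move: (Xnorm s (subX V0 U0)) (L1norm s Ts (subF g f)) (L1norm s Ts g) (L1norm s t g).
  move=> x y z w; lra.
have self : Xnorm s (subX U0 U0) + L1norm s Ts (subF f f) < 1.
  by rewrite L1norm_subxx addr0 (le_lt_trans (XB_Xnorm (XB_subxx s U0))).
split.
  have TT : 0 <= T <= T by rewrite lexx ltW.
  by have [U [mU _]] := near_ex T U0 f TT iU0 hf self; exists U.
split.
  move=> U V mU mV; apply: (mild_unique K0 hK (ltW T0) _ mU mV).
  exact: rst.
move=> T1 /andP[T10 T1T].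
have TT : 0 <= T1 <= T by rewrite !ltW.
(* The neighbourhood has radius 1, the margin built into [rho]; the Lipschitz constant is that of
   [mild_dependence] at M = rho and t = T1. *)
exists 1; split=> //; exists (2 * expR (2 * (K * rho a b ^+ p + 1) * T1)); split.
  move=> V0 g iV0 hg close.
  by have [V [mV _]] := near_ex T1 V0 g TT iV0 hg close; exists V.
move=> U1 U2 f1 f2 W1 W2 iU1 hf1 c1 iU2 hf2 c2 m1 m2 t tT.
have hf1' := rst _ _ (ltW T1T) hf1; have hf2' := rst _ _ (ltW T1T) hf2.
(* W is an arbitrary mild solution; by uniqueness it is the Picard solution, so rho bounds it. *)
have bounded V0 g W : inX s V0 -> inL1 s Ts g ->
    Xnorm s (subX V0 U0) + L1norm s Ts (subF g f) < 1 -> mild s p T1 V0 g W ->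
    forall x, 0 <= x <= T1 -> XB s (W x) (rho a b).
  move=> iV0 hg close mW x xT; have [V [mV bV]] := near_ex T1 V0 g TT iV0 hg close.
  rewrite (mild_unique K0 hK (ltW T10) (rst _ _ (ltW T1T) hg) mW mV xT).
  exact: bV.
have dep := mild_dependence K0 hK (ltW T10) (inX_XB (inX_sub iU1 iU2)) hf1' hf2' m1 m2
  (bounded _ _ _ iU1 hf1 c1 m1) (bounded _ _ _ iU2 hf2 c2 m2) tT.
apply: le_trans (XB_Xnorm dep) _; rewrite [leRHS]mulrAC.
have /andP[t0 tT1] := tT.
apply: ler_pM => //; first by rewrite !mulr_ge0 ?addr_ge0 ?Xnorm_ge0 ?L1norm_ge0.
- have h := L1T T1 (subF f1 f2) TT (inL1_sub hf1 hf2).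
  apply: ler_wpM2l => //; apply: lerD => //; exact: h.
- by rewrite ler_expR ler_wpM2l// ltW.
Qed.
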